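(* Let $n\geq 7$ be an integer, $k$ a field, $S=k[x_1,\ldots,x_n]$. Let $NI(P_n^2)\subseteq S$ be the closed neighborhood ideal of the square of the path graph $P_n$, and let $\mathcal{NI}[P_n^2]$ be the simplicial complex on $\{x_1,\ldots,x_n\}$ whose facet ideal is $NI(P_n^2)$. Then the following statements hold: (i) $S/NI(P_n^2)$ is sequentially Cohen--Macaulay. (ii) $S/I_{SR(\mathcal{NI}[P_n^2])}$ is sequentially Cohen--Macaulay.
   Context: The path graph $P_n$ has vertex set $\{x_1,\ldots,x_n\}$ and edges $\{x_i,x_{i+1}\}$ for $1\le i\le n-1$. Its square $P_n^2$ has the same vertex set and edge set $\{\{x_i,x_{i+1}\}:1\le i\le n-1\}\cup\{\{x_i,x_{i+2}\}:1\le i\le n-2\}$. For a finite simple graph $G$ and a vertex $x$, $N(x)$ is the set of vertices adjacent to $x$, and $N[x]=N(x)\cup\{x\}$. For a finite simple graph $G$ with vertices $x_1,\ldots,x_n$ (identified with the variables of $S$), the closed neighborhood ideal is $NI(G)=\left(\prod_{x_j\in N[x_i]}x_j : 1\le i\le n\right)\subseteq S$. For a simplicial complex $\Delta$ on $\{x_1,\ldots,x_n\}$, the facet ideal $I(\Delta)$ is the ideal of $S$ generated by the monomials $\mathbf{x}_F=\prod_{x_i\in F}x_i$, $F$ a facet of $\Delta$, and the Stanley--Reisner ideal $I_\Delta$ is generated by the monomials $\mathbf{x}_F$ with $F\subseteq\{x_1,\ldots,x_n\}$, $F\notin\Delta$. The complex $\mathcal{NI}[P_n^2]$ is the one with $I(\mathcal{NI}[P_n^2])=NI(P_n^2)$;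 its facets are $F_1=\{x_1,x_2,x_3\}$, $F_{n-4}=\{x_{n-2},x_{n-1},x_n\}$ and $F_i=\{x_i,x_{i+1},x_{i+2},x_{i+3},x_{i+4}\}$ for $2\le i\le n-5$. For a simplicial complex $\Delta$, $SR(\Delta)$ denotes the simplicial complex such that $I_{SR(\Delta)}=I(\Delta)$. A finitely generated graded $S$-module $M$ is sequentially Cohen--Macaulay if there is a finite filtration $0=M_0\subset M_1\subset\cdots\subset M_r=M$ by graded submodules such that each $M_i/M_{i-1}$ is Cohen--Macaulay and $\dim(M_1/M_0)<\dim(M_2/M_1)<\cdots<\dim(M_r/M_{r-1})$. *)

(* Defs.v *)
From HB Require Import structures.
From mathcomp Require Import all_boot all_order all_algebra.
From mathcomp Require Import boolp.
From mathcomp.multinomials Require Import mpoly.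

Set Implicit Arguments.
Unset Strict Implicit.
Unset Printing Implicit Defensive.

Import GRing.Theory.

Local Open Scope ring_scope.
Local Open Scope quotient_scope.

Section SubQuotient.

Variables (R : nzRingType) (V : lmodType R).

(* An alias of the predicate [N]: the structure [submodClosed] does not record
   closure under opposites, which [Quotient.quot] needs. *)
Definition submod_pred (N : submodClosed V) : {pred V} := N.

Lemma submod_predP (N : submodClosed V) : submod_closed (submod_pred N).
Proof.
split=> [|a x y xN yN]; first exact: (rpred0 N).
have axN : a *: x \in N := rpredZ a xN.
by have := rpredD axN (yN : y \in N).
Qed.

HB.instance Definition _ (N : submodClosed V) :=
  GRing.isSubmodClosed.Build R V (submod_pred N) (submod_predP N).

Definition submod (N : submodClosed V) : Type := {x : V | x \in submod_pred N}.

HB.instance Definition _ (N : submodClosed V) := SubChoice.on (submod N).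
HB.instance Definition _ (N : submodClosed V) :=
  [SubChoice_isSubLmodule of submod N by <:].

Definition quotmod (N : submodClosed V) : Type := Quotient.quot (submod_pred N).

HB.instance Definition _ (N : submodClosed V) :=
  ZmodQuotient.on (quotmod N).

Section Scale.
Variable N : submodClosed V.

Definition quotmod_scale (a : R) : quotmod N -> quotmod N :=
  lift_op1 (quotmod N) (fun x : V => a *: x).

Lemma pi_quotmod_scale a :
  {morph \pi_(quotmod N) : x / a *: x >-> quotmod_scale a x}.
Proof.
move=> x; unlock quotmod_scale; apply/eqP.
rewrite -Quotient.idealrBE -scalerBr (rpredZ (s := N)) //.
by rewrite -[_ \in _]/(_ \in submod_pred N) Quotient.idealrBE reprK.
Qed.

Let scaleA a b (x : quotmod N) :
  quotmod_scale a (quotmod_scale b x) = quotmod_scale (a * b) x.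
Proof. by rewrite -[x]reprK -!pi_quotmod_scale scalerA. Qed.

Let scale1 : left_id 1 quotmod_scale.
Proof. by move=> x; rewrite -[x]reprK -pi_quotmod_scale scale1r. Qed.

Let scaleDr : right_distributive quotmod_scale +%R.
Proof.
move=> a x y; rewrite -[x]reprK -[y]reprK.
by rewrite -(raddfD (\pi_(quotmod N))) -!pi_quotmod_scale scalerDr raddfD.
Qed.

Let scaleDl (x : quotmod N) :
  {morph (quotmod_scale^~ x) : a b / a + b}.
Proof.
by move=> a b; rewrite -[x]reprK -!pi_quotmod_scale scalerDl raddfD.
Qed.

HB.instance Definition _ := GRing.Zmodule_isLmodule.Build R (quotmod N)
  scaleA scale1 scaleDr scaleDl.

Lemma quotmod_scaleE a x : a *: \pi_(quotmod N) x = \pi_(quotmod N) (a *: x).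
Proof. by rewrite pi_quotmod_scale. Qed.

End Scale.

End SubQuotient.

Section TraceQuotient.

Variables (R : nzRingType) (V : lmodType R).

(* [N' / N] for submodules [N] and [N'] of [V], as the quotient of the module
   [submod N'] by the trace of [N] on it. *)
Definition trace_pred (N N' : submodClosed V) : {pred submod N'} :=
  [pred x | val x \in N].
Arguments trace_pred : clear implicits.

Lemma trace_predP (N N' : submodClosed V) : submod_closed (trace_pred N N').
Proof.
split=> [|a x y]; rewrite !inE ?raddf0 ?rpred0 // => xN yN.
by rewrite linearP rpredD ?rpredZ.
Qed.

HB.instance Definition _ (N N' : submodClosed V) :=
  GRing.isSubmodClosed.Build R (submod N') (trace_pred N N') (trace_predP N N').

Definition subquot (N N' : submodClosed V) := quotmod (trace_pred N N').

End TraceQuotient.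

Section Modules.

Variables (R : comNzRingType) (M : lmodType R).

(* [x] lies in the submodule (s_0, ..., s_(r-1)) M. *)
Definition in_mulmod (s : seq R) (x : M) : Prop :=
  exists y : nat -> M, x = \sum_(i < size s) s`_i *: y i.

Definition finitely_generated : Prop :=
  exists s : seq M, forall x, exists a : nat -> R,
    x = \sum_(i < size s) a i *: s`_i.

Definition in_ann (a : R) : Prop := forall x : M, a *: x = 0.

(* There is a chain P_0 < ... < P_d of prime ideals containing Ann M. *)
Definition has_prime_chain (d : nat) : Prop :=
  exists P : nat -> prime_idealr R,
    [/\ forall a, in_ann a -> a \in P 0%N
      & forall i, (i < d)%N ->
          {subset P i <= P i.+1} /\ ~ {subset P i.+1 <= P i}].

(* The Krull dimension of M, i.e. of R / Ann M, is [d]; no [d] qualifies when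
   M = 0 or when the dimension is infinite. *)
Definition krull_dim_is (d : nat) : Prop :=
  has_prime_chain d /\ forall e, has_prime_chain e -> (e <= d)%N.

Definition regular_seq (s : seq R) : Prop :=
  (forall i, (i < size s)%N -> forall x : M,
     in_mulmod (take i s) (s`_i *: x) -> in_mulmod (take i s) x)
  /\ exists x : M, ~ in_mulmod s x.

End Modules.

Section GradedModules.

Variables (k : fieldType) (n : nat).
Local Notation S := {mpoly k[n]}.

(* [p] belongs to the graded maximal ideal (x_1, ..., x_n). *)
Definition in_irrelevant (p : S) : Prop := p@_0%MM = 0.

Section OneModule.
Variable M : lmodType S.

Definition has_regular_seq (d : nat) : Prop :=
  exists s : seq S,
    [/\ size s = d, forall p, p \in s -> in_irrelevant p & regular_seq M s].

Definition depth_is (d : nat) : Prop :=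
  has_regular_seq d /\ forall e, has_regular_seq e -> (e <= d)%N.

Definition cohen_macaulay : Prop :=
  exists d, krull_dim_is M d /\ depth_is d.

(* [gr d] is the homogeneous component of degree [d] of M. *)
Definition is_grading (gr : int -> M -> Prop) : Prop :=
  [/\ forall d, gr d 0 /\ (forall x y, gr d x -> gr d y -> gr d (x - y)),
      forall (e : nat) (d : int) (p : S) (x : M),
        p \is e.-homog -> gr d x -> gr (e%:Z + d) (p *: x),
      forall x, exists (s : seq int) (c : int -> M),
        [/\ uniq s, forall d, gr d (c d) & x = \sum_(d <- s) c d]
    & forall (s : seq int) (c : int -> M), uniq s -> (forall d, gr d (c d)) ->
        \sum_(d <- s) c d = 0 -> forall d, d \in s -> c d = 0].

Definition graded_submodule (gr : int -> M -> Prop) (N : submodClosed M) :=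
  forall x, x \in N -> exists (s : seq int) (c : int -> M),
    [/\ uniq s, forall d, gr d (c d) /\ c d \in N & x = \sum_(d <- s) c d].

End OneModule.

(* That M is finitely generated and graded by [gr] is part of the definition. *)
Definition sequentially_CM (M : lmodType S) (gr : int -> M -> Prop) : Prop :=
  [/\ is_grading gr, finitely_generated M &
    exists (r : nat) (F : nat -> submodClosed M) (dims : nat -> nat),
    [/\ F 0%N =i pred1 0 /\ F r =i predT,
        forall i, (i <= r)%N -> graded_submodule gr (F i),
        forall i, (i < r)%N ->
          {subset F i <= F i.+1} /\ ~ {subset F i.+1 <= F i},
        forall i, (i < r)%N -> cohen_macaulay (subquot (F i) (F i.+1))
      & (forall i, (i < r)%N -> krull_dim_is (subquot (F i) (F i.+1)) (dims i))
        /\ forall i j, (i < j < r)%N -> (dims i < dims j)%N]].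

Definition ideal_pred (G : seq S) : {pred S^o} :=
  [pred p | `[< in_mulmod (M := S^o) G p >]].

Lemma ideal_predP (G : seq S) : submod_closed (ideal_pred G).
Proof.
split=> [|a p q]; rewrite /ideal_pred !unfold_in.
  apply/asboolP; exists (fun=> 0); rewrite big1 // => i _.
  by rewrite scaler0.
move=> /asboolP[y ->] /asboolP[z ->]; apply/asboolP.
exists (fun i => a *: y i + z i).
rewrite scaler_sumr -big_split; apply: eq_bigr => i _ /=.
by rewrite scalerDr !scalerA mulrC.
Qed.

HB.instance Definition _ (G : seq S) :=
  GRing.isSubmodClosed.Build S S^o (ideal_pred G) (ideal_predP G).

Definition ideal_gen (G : seq S) : submodClosed S^o := ideal_pred G.

(* The grading of S / I induced by the standard grading of S. *)
Definition quot_grading (I : submodClosed S^o) (d : int) (x : quotmod I) : Prop :=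
  match d with
  | Posz e => exists2 p : S, p \is e.-homog & x = \pi_(quotmod I) (p : S^o)
  | Negz _ => x = 0
  end.

Definition quotient_sequentially_CM (I : submodClosed S^o) : Prop :=
  sequentially_CM (@quot_grading I).

Definition xmon (F : {set 'I_n}) : S := \prod_(i in F) 'X_i.

Definition sqfree_ideal (A : {set {set 'I_n}}) : submodClosed S^o :=
  ideal_gen [seq xmon F | F <- enum A].

Lemma mem_ideal_gen (G : seq S) p : p \in G -> p \in ideal_gen G.
Proof.
move=> Gp; apply/asboolP; exists (fun i => (i == index p G)%:R).
have lt_p : (index p G < size G)%N by rewrite index_mem.
rewrite (bigD1 (Ordinal lt_p)) //= big1 ?addr0 => [|i].
  by rewrite eqxx nth_index // /GRing.scale /= mulr1.
by rewrite -val_eqE /= => /negPf->; rewrite scaler0.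
Qed.

Lemma ideal_gen_sub (G : seq S) (I : submodClosed S^o) :
  {in G, forall p, p \in I} -> {subset ideal_gen G <= I}.
Proof.
move=> GI p /asboolP[y ->]; apply: rpred_sum => i _.
by rewrite /GRing.scale /= mulrC; apply: rpredZ; apply/GI/mem_nth.
Qed.

Lemma mem_sqfree_ideal (A : {set {set 'I_n}}) (F : {set 'I_n}) :
  (xmon F \in sqfree_ideal A) = [exists F' in A, F' \subset F].
Proof.
apply/idP/existsP => [/asboolP[y eqF]|[F' /andP[AF' sF'F]]].
  apply/existsP; apply: contra_eqT eqF => /existsPn nAF.
  apply/eqP => /(congr1 (meval (fun i => (i \in F)%:R))).
  rewrite rmorph_prod /= big1 => [|i Fi]; last by rewrite mevalXU Fi.
  rewrite rmorph_sum /= big1 => [/eqP|i _]; first by rewrite oner_eq0.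
  have : nth 0 [seq xmon F | F <- enum A] i \in [seq xmon F | F <- enum A].
    exact: mem_nth.
  case/mapP=> F'; rewrite mem_enum => AF' ->; rewrite mevalM.
  have := nAF F'; rewrite AF' => /subsetPn[j F'j nFj].
  by rewrite rmorph_prod /= (bigD1 j) //= mevalXU (negPf nFj) !mul0r.
have -> : xmon F = xmon (F :\: F') * xmon F'.
  rewrite /xmon (bigID (mem F')) mulrC /=; congr (_ * _).
    apply: eq_bigl => i; rewrite andbC.
    by case: (boolP (i \in F')) => // /(subsetP sF'F).
  by apply: eq_bigl => i; rewrite in_setD andbC.
apply: (rpredZ (V := S^o)); apply/mem_ideal_gen/mapP.
by exists F'; rewrite ?mem_enum.
Qed.

Lemma eq_sqfree_ideal (A B : {set {set 'I_n}}) :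
  (forall F : {set 'I_n}, [exists F' in A, F' \subset F] = [exists F' in B, F' \subset F]) ->
  sqfree_ideal A =i sqfree_ideal B.
Proof.
have sub (A' B' : {set {set 'I_n}}) : (forall F : {set 'I_n}, [exists F' in A', F' \subset F] =
    [exists F' in B', F' \subset F]) -> {subset sqfree_ideal A' <= sqfree_ideal B'}.
  move=> eqAB; apply: ideal_gen_sub => _ /mapP[F + ->]; rewrite mem_enum => A'F.
  by rewrite mem_sqfree_ideal -eqAB; apply/existsP; exists F; rewrite A'F /=.
by move=> eqAB p; apply/idP/idP; apply: sub.
Qed.

(* Only closure under subsets is required, so that [SR] below is total; the
   void complex, without faces, is allowed. *)
Record simplicial_complex := SimplicialComplex {
  faces : {set {set 'I_n}};
  faces_sub : forall F F' : {set 'I_n}, F \in faces -> F' \subset F -> F' \in faces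
}.

Definition facets (D : simplicial_complex) : {set {set 'I_n}} :=
  [set F | maxset (mem (faces D)) F].

Definition facet_ideal (D : simplicial_complex) : submodClosed S^o :=
  sqfree_ideal (facets D).

Definition stanley_reisner_ideal (D : simplicial_complex) : submodClosed S^o :=
  sqfree_ideal (~: faces D).

Lemma SR_faces_sub (D : simplicial_complex) (F F' : {set 'I_n}) :
  F \in [set F : {set 'I_n} | ~~ [exists H in facets D, H \subset F]] -> F' \subset F ->
  F' \in [set F : {set 'I_n} | ~~ [exists H in facets D, H \subset F]].
Proof.
rewrite !inE => nF sF'F; apply: contra nF => /existsP[H /andP[DH sHF']].
by apply/existsP; exists H; rewrite DH (subset_trans sHF').
Qed.

(* The faces of SR(D) are the sets F with x_F not in I(D), by
   [mem_sqfree_ideal]; [stanley_reisner_ideal_SR] and [SR_unique] are the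
   defining property of SR(D). *)
Definition SR (D : simplicial_complex) : simplicial_complex :=
  SimplicialComplex (@SR_faces_sub D).

Lemma stanley_reisner_ideal_SR (D : simplicial_complex) :
  stanley_reisner_ideal (SR D) =i facet_ideal D.
Proof.
apply: eq_sqfree_ideal => F; apply/existsP/existsP.
  case=> F'; rewrite !inE negbK => /andP[/existsP[H /andP[DH sHF']] sF'F].
  by exists H; rewrite DH (subset_trans sHF').
case=> H /andP[DH sHF]; exists H; rewrite sHF andbT !inE negbK.
by apply/existsP; exists H; rewrite DH /=.
Qed.

Lemma SR_unique (D E : simplicial_complex) :
  stanley_reisner_ideal E =i facet_ideal D -> faces E = faces (SR D).
Proof.
move=> eqDE; apply/setP=> F; rewrite inE; have := eqDE (xmon F).
rewrite !mem_sqfree_ideal => <-; rewrite negb_exists.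
apply/idP/forallP => [EF F'|/(_ F)]; last by rewrite inE subxx andbT negbK.
by rewrite inE negb_and negbK orbC -implybE; apply/implyP/faces_sub.
Qed.

Lemma mem_faces (D : simplicial_complex) (F : {set 'I_n}) :
  (F \in faces D) = [exists H in facets D, F \subset H].
Proof.
apply/idP/existsP => [DF|[H /andP[]]].
  have [H maxH sFH] := maxset_exists (P := mem (faces D)) DF.
  by exists H; rewrite inE maxH.
by rewrite inE => /maxsetP[DH _]; apply: faces_sub.
Qed.

Lemma facet_ideal_inj (D E : simplicial_complex) :
  facet_ideal D =i facet_ideal E -> faces D = faces E.
Proof.
have sub (D' E' : simplicial_complex) :
  facet_ideal D' =i facet_ideal E' -> {subset facets D' <= facets E'}.
  move=> eqDE H DH.
  have : xmon H \in facet_ideal E'.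
    by rewrite -eqDE; apply/mem_ideal_gen/mapP; exists H; rewrite ?mem_enum.
  rewrite mem_sqfree_ideal => /existsP[H1 /andP[EH1 sH1H]].
  have : xmon H1 \in facet_ideal D'.
    by rewrite eqDE; apply/mem_ideal_gen/mapP; exists H1; rewrite ?mem_enum.
  rewrite mem_sqfree_ideal => /existsP[H2 /andP[DH2 sH2H1]].
  have eqH : H2 = H.
    move: DH2 DH; rewrite !inE => /maxsetP[_ max2] /maxsetP[DH _].
    by rewrite (max2 H) // (subset_trans sH2H1).
  suff -> : H = H1 by [].
  by apply/eqP; rewrite eqEsubset sH1H -{1}eqH sH2H1.
move=> eqDE; apply/setP=> F; rewrite !mem_faces.
by apply/existsP/existsP => -[H /andP[DH sFH]]; exists H;
  rewrite sFH andbT; apply: sub DH => p; rewrite eqDE.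
Qed.

Record simple_graph := SimpleGraph {
  adj : rel 'I_n;
  adj_sym : ssrbool.symmetric adj;
  adj_irr : irreflexive adj
}.

Variable G : simple_graph.

Definition closed_nbhd (i : 'I_n) : {set 'I_n} := [set j | (j == i) || adj G i j].

Definition closed_nbhds : {set {set 'I_n}} := [set closed_nbhd i | i : 'I_n].

Definition NI : submodClosed S^o :=
  ideal_gen [seq \prod_(j in closed_nbhd i) 'X_j | i : 'I_n].

Definition minimal_nbhds : {set {set 'I_n}} :=
  [set F | minset (mem closed_nbhds) F].

Lemma nbhd_faces_sub (F F' : {set 'I_n}) :
  F \in [set F : {set 'I_n} | [exists H in minimal_nbhds, F \subset H]] ->
  F' \subset F ->
  F' \in [set F : {set 'I_n} | [exists H in minimal_nbhds, F \subset H]].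
Proof.
rewrite !inE => /existsP[H /andP[GH sFH]] sF'F.
by apply/existsP; exists H; rewrite GH (subset_trans sF'F).
Qed.

(* The complex whose facet ideal is NI(G): the minimal generators of NI(G)
   come from the inclusion-minimal closed neighborhoods, which are therefore
   its facets; see [facet_ideal_nbhd_complex] and [nbhd_complex_unique]. *)
Definition nbhd_complex : simplicial_complex := SimplicialComplex nbhd_faces_sub.

Lemma facets_nbhd_complex : facets nbhd_complex = minimal_nbhds.
Proof.
have facesE (F : {set 'I_n}) : (F \in faces nbhd_complex) =
    [exists H in minimal_nbhds, F \subset H] by rewrite inE.
apply/setP=> F; rewrite [LHS]inE; apply/maxsetP/idP => [[]|mF].
  change (F \in faces nbhd_complex -> (forall B : {set 'I_n},
    B \in faces nbhd_complex -> F \subset B -> B = F) -> F \in minimal_nbhds).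
  rewrite facesE => /existsP[H /andP[mH sFH]] maxF.
  rewrite -(maxF H) // facesE; apply/existsP; exists H.
  by rewrite mH /=.
split=> [|F'].
  by change (F \in faces nbhd_complex); rewrite facesE; apply/existsP; exists F; rewrite mF /=.
change (F' \in faces nbhd_complex -> F \subset F' -> F' = F).
rewrite facesE => /existsP[H /andP[mH sF'H]] sFF'; apply/eqP.
rewrite eqEsubset sFF' andbT; suff -> : F = H by [].
move: mH mF; rewrite !inE => /minsetP[_ minH] /minsetP[GF _].
by apply: minH => //; apply: subset_trans sF'H.
Qed.

Lemma NI_sqfree : NI =i sqfree_ideal closed_nbhds.
Proof.
move=> p; apply/idP/idP; apply: ideal_gen_sub => _ /mapP[/= i + ->].
  move=> _; apply/mem_ideal_gen/mapP; exists (closed_nbhd i) => //.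
  by rewrite mem_enum imset_f.
rewrite mem_enum => /imsetP[j _ ->]; apply/mem_ideal_gen/mapP.
by exists j; rewrite ?mem_enum.
Qed.

Lemma facet_ideal_nbhd_complex : facet_ideal nbhd_complex =i NI.
Proof.
move=> p; rewrite NI_sqfree /facet_ideal facets_nbhd_complex.
move: p; apply: eq_sqfree_ideal => F; apply/existsP/existsP.
  by case=> H; rewrite inE => /andP[/minsetP[GH _] sHF]; exists H; apply/andP.
case=> H /andP[GH sHF]; have [H' mH' sH'H] := minset_exists (P := mem closed_nbhds) GH.
by exists H'; rewrite inE mH' (subset_trans sH'H).
Qed.

Lemma nbhd_complex_unique (D : simplicial_complex) :
  facet_ideal D =i NI -> faces D = faces nbhd_complex.
Proof.
by move=> eqD; apply: facet_ideal_inj => p; rewrite eqD facet_ideal_nbhd_complex.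
Qed.

End GradedModules.

Section PathSquare.

Variable n : nat.

(* The vertex x_(i+1) is represented by i : 'I_n. *)
Definition path_square_rel : rel 'I_n := fun i j =>
  [|| (j == i.+1 :> nat), (i == j.+1 :> nat),
      (j == i.+2 :> nat) | (i == j.+2 :> nat)].

Lemma path_square_sym : ssrbool.symmetric path_square_rel.
Proof. by move=> i j; rewrite /path_square_rel orbCA; congr [|| _, _ | _]; exact: orbC. Qed.

Lemma path_square_irr : irreflexive path_square_rel.
Proof.
move=> i; rewrite /path_square_rel.
by rewrite (ltn_eqF (ltnSn i)) (ltn_eqF (ltnW (ltnSn i.+1))).
Qed.

Definition path_square : simple_graph n :=
  SimpleGraph path_square_sym path_square_irr.

End PathSquare.

(* Main.v *)
(* The squarefree monomial ideals involved are I_U, spanned by the monomials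
   whose support lies in an up-set U of sets of variables; NI(P_n^2) is I_U for
   the up-set generated by the closed neighbourhoods, which are intervals.  Let
   Delta be the complementary complex.  The filtration of S/I is the dimension
   filtration: its d-th term is spanned by the monomials whose support lies only
   in faces with at most d elements.

   Combinatorics: if x is the least right end of an interval, then x is a
   shedding vertex of Delta, so each layer of the filtration is glued from the
   corresponding layers of the link and of the deletion of x.  By induction each
   layer is filtered by cyclic modules isomorphic to k[x_i : i in F] with #|F| = d.

   Algebra: on such a layer the elementary symmetric polynomials e_d, ..., e_1
   form a regular sequence, since modulo e_d the ring k[x_i : i in F] becomes the
   Stanley-Reisner ring of the boundary of a simplex, which is filtered in the
   same way with d - 1 in place of d.  Conversely any d + 1 polynomials satisfy a
   nontrivial polynomial relation on the layer.  Dividing by the least monomial of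
   that relation, step by step, bounds both the length of the chains of primes
   containing the annihilator and the length of the regular sequences by d. *)

Require Import Defs.
From HB Require Import structures.
From mathcomp Require Import all_boot all_order all_algebra.
From mathcomp Require Import ring zify boolp.
From mathcomp.multinomials Require Import mpoly.

Set Implicit Arguments.
Unset Strict Implicit.
Unset Printing Implicit Defensive.

Import GRing.Theory.
Local Open Scope ring_scope.
Local Open Scope quotient_scope.

(** * Regular sequences and relations on subquotients *)

Section Pairs.

Variables (R : comNzRingType).

Section OneModule.
Variable V : lmodType R.

Definition submodule (N : V -> Prop) : Prop :=
  N 0 /\ forall a x y, N x -> N y -> N (x - a *: y).

Lemma submodule0 N : submodule N -> N 0. Proof. by case. Qed.

Lemma submoduleBZ N a x y : submodule N -> N x -> N y -> N (x - a *: y).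
Proof. by case=> _; apply. Qed.

Lemma submoduleB N x y : submodule N -> N x -> N y -> N (x - y).
Proof. by move=> [_ NB] Nx Ny; have := NB 1 _ _ Nx Ny; rewrite scale1r. Qed.

Lemma submoduleZ N a x : submodule N -> N x -> N (a *: x).
Proof.
by move=> [N0 NB] Nx; have := NB (- a) _ _ N0 Nx; rewrite scaleNr opprK add0r.
Qed.

Lemma submoduleD N x y : submodule N -> N x -> N y -> N (x + y).
Proof.
move=> sN Nx Ny; rewrite -[y]opprK; apply: submoduleB => //.
by rewrite -scaleN1r; apply: submoduleZ.
Qed.

Definition addmul (a : R) (N' N : V -> Prop) (x : V) : Prop :=
  exists2 y, N' y & N (x - a *: y).

Lemma addmul_submodule a N' N :
  submodule N' -> submodule N -> submodule (addmul a N' N).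
Proof.
move=> sN' sN; split.
  by exists 0; [exact: submodule0 | rewrite scaler0 subr0; exact: submodule0].
move=> b x y [x' N'x' Nx] [y' N'y' Ny]; exists (x' - b *: y').
  exact: submoduleBZ.
have -> : x - b *: y - a *: (x' - b *: y') = (x - a *: x') - b *: (y - a *: y').
  rewrite !scalerBr !scalerA (mulrC a b) !opprB [b * a *: _ - _]addrC addrACA.
  by rewrite [- _ + b * a *: _]addrC.
exact: submoduleBZ.
Qed.

Lemma addmul_sub a N' N x : submodule N' -> N x -> addmul a N' N x.
Proof.
by move=> sN' Nx; exists 0; rewrite ?scaler0 ?subr0 //; exact: submodule0.
Qed.

Lemma addmul_subset a (N' N : V -> Prop) x : submodule N' ->
  (forall y, N y -> N' y) -> addmul a N' N x -> N' x.
Proof.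
move=> sN' NN' [y N'y /NN' Nx]; rewrite -[x](subrK (a *: y)).
by apply: submoduleD => //; apply: submoduleZ.
Qed.

Lemma addmul_mono a (A A' B B' : V -> Prop) x :
  (forall y, A y -> A' y) -> (forall y, B y -> B' y) ->
  addmul a A B x -> addmul a A' B' x.
Proof. by move=> AA' BB' [y Ay Bx]; exists y; auto. Qed.

(** Weak regularity on N' / N: the condition that the final quotient is nonzero is kept apart.
    Dividing by [a] means enlarging [N] to N + a N', so no quotient module is formed. *)
Fixpoint wreg (s : seq R) (N' N : V -> Prop) : Prop :=
  if s is a :: s' then
    (forall x, N' x -> N (a *: x) -> N x) /\ wreg s' N' (addmul a N' N)
  else True.

Fixpoint addmuls (s : seq R) (N' N : V -> Prop) : V -> Prop :=
  if s is a :: s' then addmuls s' N' (addmul a N' N) else N.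

Lemma addmulsP s (N' N : V -> Prop) x : N' 0 ->
  addmuls s N' N x <-> exists2 y : nat -> V, forall i, N' (y i)
                      & N (x - \sum_(i < size s) s`_i *: y i).
Proof.
move=> N'0; elim: s N x => [|a s IHs] N x /=.
  split=> [Nx|[y _]]; last by rewrite big_ord0 subr0.
  by exists (fun=> 0) => [i|]; rewrite ?big_ord0 ?subr0.
split=> [/IHs[y N'y [z N'z Nx]]|[y N'y Nx]].
  exists (fun i => if i is j.+1 then y j else z) => [[|i]//|].
  by rewrite big_ord_recl /= opprD addrA addrAC.
apply/IHs; exists (y \o succn) => [i|]; first exact: N'y.
by exists (y 0%N) => //; move: Nx; rewrite big_ord_recl /= opprD addrA addrAC.
Qed.

Lemma eq_wreg s (A A' B B' : V -> Prop) :
  (forall x, A x <-> A' x) -> (forall x, B x <-> B' x) -> wreg s A B -> wreg s A' B'.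
Proof.
move=> AA'; elim: s B B' => [//|a s IHs] B B' BB' [ra rs]; split.
  by move=> x /AA' Ax /BB' Bax; apply/BB'/ra.
apply: IHs rs => x; split; apply: addmul_mono => y; by [case: (AA' y)|case: (BB' y)].
Qed.

Lemma wreg_trivial s (N' N : V -> Prop) : submodule N' ->
  (forall x, N' x -> N x) -> wreg s N' N.
Proof.
move=> sN'; elim: s N => //= a s IHs N sub; split; first by move=> x /sub.
by apply: IHs => x /sub; apply: addmul_sub.
Qed.

Lemma addmuls_mono s (A A' B B' : V -> Prop) x :
  (forall y, A y -> A' y) -> (forall y, B y -> B' y) ->
  addmuls s A B x -> addmuls s A' B' x.
Proof.
move=> AA'; elim: s B B' => [|a s IHs] B B' BB' /=; first exact: BB'.
by apply: IHs => y; apply: addmul_mono.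
Qed.

Lemma wregP s N' N :
  wreg s N' N <-> forall i, (i < size s)%N -> forall x, N' x ->
    addmuls (take i s) N' N (s`_i *: x) -> addmuls (take i s) N' N x.
Proof.
elim: s N => [|a s IHs] N //=; split=> [[ra rs] [|i] lti //=|rs].
  by have /IHs := rs; apply.
split; first exact: (rs 0%N).
by apply/IHs => i lti x N'x; apply: (rs i.+1).
Qed.

End OneModule.

(* [f] induces an isomorphism from A' / A to B' / B; outside A' it is arbitrary. *)
Definition pair_iso (V W : lmodType R) (A' A : V -> Prop) (B' B : W -> Prop)
    (f : V -> W) : Prop :=
  [/\ forall a x y, A' x -> A' y -> f (x - a *: y) = f x - a *: f y,
      forall x, A' x -> B' (f x),
      forall y, B' y -> exists2 x, A' x & B (y - f x)
    & forall x, A' x -> A x <-> B (f x)].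

Lemma pair_iso0 (V W : lmodType R) (A' A : V -> Prop) (B' B : W -> Prop) f :
  submodule A' -> pair_iso A' A B' B f -> f 0 = 0.
Proof.
move=> sA' [fB _ _ _]; have A0 : A' 0 := submodule0 sA'.
by have := fB 1 0 0 A0 A0; rewrite scaler0 subr0 scale1r subrr.
Qed.

Lemma pair_isoZ (V W : lmodType R) (A' A : V -> Prop) (B' B : W -> Prop) f a x :
  submodule A' -> pair_iso A' A B' B f -> A' x -> f (a *: x) = a *: f x.
Proof.
move=> sA' isof A'x; have f0 := pair_iso0 sA' isof.
case: isof => fB _ _ _; have A0 : A' 0 := submodule0 sA'.
by have := fB (- a) 0 x A0 A'x; rewrite f0 !scaleNr !opprK !add0r.
Qed.

Lemma pair_iso_addmul (V W : lmodType R) (A' A : V -> Prop) (B' B : W -> Prop) f a :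
  submodule A' -> submodule B ->
  pair_iso A' A B' B f -> pair_iso A' (addmul a A' A) B' (addmul a B' B) f.
Proof.
move=> sA' sB isof; have f0 := pair_iso0 sA' isof.
case: isof => fB fA' fsurj fA; split=> // [y B'y|x A'x].
  have [x A'x Byx] := fsurj _ B'y; exists x => //; exists (f 0).
    by apply: fA'; apply: submodule0.
  by rewrite f0 scaler0 subr0.
split=> [[y A'y Ax]|[y' B'y' Bx]].
  by exists (f y); [exact: fA' | rewrite -fB //; apply/fA => //; exact: submoduleBZ].
have [y A'y By] := fsurj _ B'y'; exists y => //.
apply/fA; first exact: submoduleBZ.
rewrite fB // -[f x](subrK (a *: y')) -addrA -scalerBr.
by apply: submoduleD => //; apply: submoduleZ.
Qed.

Lemma wreg_iso (V W : lmodType R) (A' A : V -> Prop) (B' B : W -> Prop) f s :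
  submodule A' -> submodule A -> submodule B' -> submodule B ->
  pair_iso A' A B' B f -> wreg s A' A <-> wreg s B' B.
Proof.
move=> sA' + sB' +; elim: s A B => [//|a s IHs] A B sA sB isof /=.
have {}IHs : wreg s A' (addmul a A' A) <-> wreg s B' (addmul a B' B).
  by apply: IHs; [exact: addmul_submodule..|exact: pair_iso_addmul].
have fZ x : A' x -> f (a *: x) = a *: f x by move=> A'x; apply: pair_isoZ isof A'x.
case: isof => fB fA' fsurj fA; split=> -[ra /IHs rs]; split=> // x.
  move=> B'x Bax; have [y A'y Bxy] := fsurj _ B'x.
  suff Bfy : B (f y) by rewrite -[x](subrK (f y)); apply: submoduleD.
  apply/fA => //; apply: ra => //; apply/fA; first exact: submoduleZ.
  have -> : f (a *: y) = a *: x - a *: (x - f y).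
    by rewrite scalerBr opprB addrC subrK fZ.
  exact: submoduleBZ.
move=> A'x Aax; apply/fA => //; apply: ra; first exact: fA'.
by rewrite -fZ //; apply/fA => //; apply: submoduleZ.
Qed.

Lemma addmuls_iso (V W : lmodType R) (A' A : V -> Prop) (B' B : W -> Prop) f s x :
  submodule A' -> submodule A -> submodule B' -> submodule B ->
  pair_iso A' A B' B f -> A' x -> addmuls s A' A x <-> addmuls s B' B (f x).
Proof.
move=> sA' + sB' + + A'x; elim: s A B => [|a s IHs] A B sA sB isof /=.
  by case: isof => _ _ _; apply.
by apply: IHs; [exact: addmul_submodule..|exact: pair_iso_addmul].
Qed.

(* Regularity on N2 / N1 makes (N1 + a N2) / (N0 + a N2) isomorphic to
   N1 / (N0 + a N1). *)
Lemma wreg_ext (V : lmodType R) (N0 N1 N2 : V -> Prop) s :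
  submodule N0 -> submodule N1 -> submodule N2 ->
  (forall x, N0 x -> N1 x) -> (forall x, N1 x -> N2 x) ->
  wreg s N1 N0 -> wreg s N2 N1 -> wreg s N2 N0.
Proof.
move=> + + sN2; elim: s N0 N1 => [//|a s IHs] N0 N1 sN0 sN1 N01 N12 /=.
move=> [r1 rs1] [r2 rs2]; split=> [x N2x N0ax|].
  by apply: r1 => //; apply: r2 => //; apply: N01.
apply: (IHs (addmul a N2 N0) (addmul a N2 N1)) rs2.
- exact: addmul_submodule.
- exact: addmul_submodule.
- by move=> x; apply: addmul_mono.
- by move=> x; apply: addmul_subset.
suff iso : pair_iso N1 (addmul a N1 N0) (addmul a N2 N1) (addmul a N2 N0) id.
  by apply: (wreg_iso _ _ _ _ _ iso).1 rs1; [by []|exact: addmul_submodule..].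
split=> // [x N1x|y [z N2z N1yz]|x N1x]; first exact: addmul_sub.
  exists (y - a *: z) => //; exists z => //.
  by rewrite /= opprB addrCA subrr addr0 subrr; exact: submodule0.
split; first exact: addmul_mono.
(* Both x and x - a y lie in N1, hence so does a y; regularity of [a] on N2 / N1 puts y in N1. *)
case=> y N2y N0xay; exists y => //; apply: r2 => //.
have := submoduleB sN1 N1x (N01 _ N0xay).
by rewrite opprB addrC subrK.
Qed.

(* The shape which a polynomial relation between the members of [s] takes when
   its lexicographically least monomial is factored out, as in Coquand and
   Lombardi's characterisation of the Krull dimension. *)
Fixpoint collapse (s : seq R) (a : R) : Prop :=
  if s is x :: s' then
    exists m b r, collapse s' b /\ a = x ^+ m * (b + x * r)
  else exists b, b * a = 1.

Lemma collapseM s a b : collapse s a -> collapse s b -> collapse s (a * b).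
Proof.
elim: s a b => [|x s IHs] a b /=.
  by case=> a' aa' [b' bb']; exists (a' * b'); rewrite mulrACA aa' bb' mulr1.
case=> m [a' [r [ca' ->]]] [m' [b' [r' [cb' ->]]]].
exists (m + m')%N, (a' * b'), (a' * r' + r * b' + x * r * r').
split; first exact: IHs.
rewrite mulrACA -exprD; congr (_ * _).
ring.
Qed.

Lemma collapse_exists s : exists a, collapse s a.
Proof.
elim: s => [|x s [b cb]]; first by exists 1, 1; rewrite mulr1.
by exists b, 0%N, b, 0; rewrite expr0 mulr0 addr0 mul1r.
Qed.

(** Since x is outside P 0, so is x^m. By induction b is outside P 1, which contains x, so b + x r
    is outside P 1 and therefore outside P 0. *)
Lemma collapse_chain (P : nat -> prime_idealr R) s a :
  (forall i, (i < size s)%N ->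
     [/\ {subset P i <= P i.+1}, s`_i \notin P i & s`_i \in P i.+1]) ->
  collapse s a -> a \notin P 0%N.
Proof.
elim: s P a => [|x s IHs] P a Ps /=.
  case=> b ba; apply/negP => Pa; have : 1 \in P 0%N by rewrite -ba idealMr.
  by rewrite idealr1.
case=> m [b [r [cb ->]]]; have [sP nPx Px] := Ps 0%N isT.
have Pb : b \notin P 1%N by apply: IHs (P \o succn) b _ cb => i lti; apply: (Ps i.+1).
rewrite prime_idealrM negb_or; apply/andP; split.
  elim: m => [|m IHm]; first by rewrite expr0 idealr1.
  by rewrite exprS prime_idealrM negb_or nPx.
apply: contra Pb => /sP; rewrite rpredDr // mulrC; exact: idealMr.
Qed.

(** Regularity of [y] cancels y^m, so b x lies in N + y N' and the induction goes on there; the last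
    factor is a unit. *)
Lemma collapse_wreg (V : lmodType R) (N' N : V -> Prop) s a x :
  submodule N' -> submodule N ->
  wreg s N' N -> collapse s a -> N' x -> N (a *: x) -> addmuls s N' N x.
Proof.
move=> sN'; elim: s N a x => [|y s IHs] N a x sN /=.
  by move=> _ [b ba] _ Nax; rewrite -[x]scale1r -ba -scalerA; apply: submoduleZ.
case=> ry rs [m [b [r [cb ->]]]] N'x Nax.
apply: (IHs _ _ _ (addmul_submodule y sN' sN) rs cb N'x).
exists (- r *: x); first exact: submoduleZ.
rewrite scalerA mulrN scaleNr opprK -scalerDl.
elim: m Nax => [|m IHm]; first by rewrite expr0 mul1r.
rewrite exprS -mulrA -scalerA => Nax; apply: IHm; apply: ry => //.
exact: submoduleZ.
Qed.

End Pairs.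

(** * Polynomial relations by counting monomials *)

Section Relations.

Variables (k : fieldType) (n : nat).
Local Notation S := {mpoly k[n]}.

Definition msupport (m : 'X_{1..n}) : {set 'I_n} := [set i | m i != 0%N].

Fixpoint exponents (N d : nat) : finType :=
  if d is d'.+1 then ('I_N * exponents N d')%type else unit.

Fixpoint power_prod (N : nat) (s : seq S) : exponents N (size s) -> S :=
  if s is x :: s' then fun e => x ^+ e.1 * power_prod e.2 else fun=> 1.

Lemma card_exponents N d : #|exponents N d| = (N ^ d)%N.
Proof.
elim: d => [|d IHd] /=; first by rewrite card_unit.
by rewrite card_prod card_ord IHd expnS.
Qed.

(** The least exponent j of x with a nonzero coefficient is factored out: the block at j collapses
    by induction, and the later blocks stay divisible by x. *)
Lemma collapse_power_prod N (s : seq S) (c : exponents N (size s) -> k) :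
  [exists e, c e != 0] -> collapse s (\sum_e c e *: power_prod e).
Proof.
elim: s c => [|x s IHs] c /existsP[e0 ce0] /=.
  exists ((c tt)^-1%:MP); rewrite (big_pred1 tt); last by case.
  by case: e0 ce0 => c0; rewrite mul_mpolyC scalerA mulVf // scale1r.
pose P (j : 'I_N) := [exists e, c (j, e) != 0].
have P0 : P e0.1 by apply/existsP; exists e0.2; rewrite -surjective_pairing.
case: (arg_minnP (fun j : 'I_N => j : nat) P0) => j Pj minj.
pose q (j : 'I_N) := \sum_e c (j, e) *: power_prod e.
exists j, (q j), (\sum_(i : 'I_N | (j < i)%N) x ^+ (i - j).-1 * q i).
split; first exact: IHs.
have -> : \sum_e c e *: (x ^+ e.1 * power_prod e.2) = \sum_(i < N) x ^+ i * q i.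
  transitivity (\sum_(i < N) \sum_(e : exponents N (size s))
      c (i, e) *: (x ^+ i * power_prod e)).
    by rewrite pair_bigA; apply: eq_bigr => -[i e] _.
  apply: eq_bigr => i _; rewrite mulr_sumr; apply: eq_bigr => e _.
  by rewrite scalerAr.
rewrite (bigID (fun i : 'I_N => j < i)%N) /= addrC (bigD1 j) ?ltnn //=.
rewrite [X in _ + X + _]big1 ?addr0 => [|i /andP[lei neij]].
  rewrite mulrDr; congr (_ + _); rewrite !mulr_sumr; apply: eq_bigr => i ltji.
  by rewrite !mulrA -exprSr -exprD; congr (x ^+ _ * _); lia.
have nPi : ~~ P i.
  apply/negP => /minj leji; move: neij lei; rewrite -leqNgt -val_eqE /= => ne lei.
  by move: ne; rewrite eqn_leq lei leji.
rewrite /q big1 ?mulr0 // => e _.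
by move/existsPn: nPi => /(_ e); rewrite negbK => /eqP->; rewrite scale0r.
Qed.

Lemma msizeM_leD a b (p q : S) :
  (msize p <= a.+1)%N -> (msize q <= b.+1)%N -> (msize (p * q) <= (a + b).+1)%N.
Proof.
have [->|p0] := eqVneq p 0; first by rewrite mul0r msize0.
have [->|q0] := eqVneq q 0; first by rewrite mulr0 msize0.
by rewrite msizeM //; move: (msize p) (msize q) => u v ua vb; lia.
Qed.

Lemma msize_power_prod N D (s : seq S) (e : exponents N (size s)) :
  {in s, forall x, (msize x <= D.+1)%N} ->
  (msize (power_prod e) <= (size s * (N * D)).+1)%N.
Proof.
elim: s e => [|x s IHs] e /= sD; first by rewrite msize1.
rewrite mulSn; apply: msizeM_leD; last first.
  by apply: IHs => y sy; apply: sD; rewrite inE sy orbT.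
have xD : (msize x <= D.+1)%N by apply: sD; rewrite mem_head.
apply: (@leq_trans (e.1 * D).+1); last by rewrite ltnS leq_mul // ltnW.
elim: (e.1 : nat) => [|j IHj]; first by rewrite expr0 msize1.
by rewrite exprS mulSn; apply: msizeM_leD.
Qed.

Lemma kermx_vector m p (A : 'M[k]_(m, p)) :
  (p < m)%N -> exists2 v : 'rV_m, v != 0 & v *m A = 0.
Proof.
move=> ltpm; have : kermx A != 0.
  by rewrite -mxrank_eq0 mxrank_ker -lt0n subn_gt0 (leq_ltn_trans (rank_leq_col A)).
by case/rowV0Pn => v /sub_kermxP vA v0; exists v.
Qed.

(* More power products than monomials: a relation modulo P_F, the ideal of the
   polynomials none of whose monomials is supported in [F]. *)
Lemma exists_collapse (F : {set 'I_n}) (s : seq S) : (#|F| < size s)%N ->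
  exists2 a, collapse s a & forall m, msupport m \subset F -> a@_m = 0.
Proof.
set d := #|F| => ltds.
pose D := (\max_(x <- s) msize x)%N.
have sD : {in s, forall x, (msize x <= D.+1)%N}.
  by move=> x sx; apply/leqW; rewrite /D (big_rem x) //= leq_maxl.
(* K exceeds the degrees of all power products, and K <= N B. As N > B^d, the power products, at
   least N^(d+1) in number, exceed (N B)^d, hence the count of monomials on F with exponents below
   K. *)
pose B := (size s * D).+1; pose N := (B ^ d).+1; pose K := (size s * (N * D)).+1.
pose G : finType := {ffun {i | i \in F} -> 'I_K}.
pose mon (g : G) : 'X_{1..n} :=
  [multinom if insub i is Some u then g u : nat else 0%N | i < n].
pose T := exponents N (size s).
pose A := \matrix_(r < #|T|, c < #|G|)
  (power_prod (enum_val r : T))@_(mon (enum_val c)).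
have ltGT : (#|G| < #|T|)%N.
  rewrite card_ffun card_ord card_sig card_exponents.
  have -> : #|[pred x in F]| = d by [].
  have leK : (K <= N * B)%N by rewrite /K /B /N; nia.
  apply: (@leq_ltn_trans ((N * B) ^ d)); first by case: (d) => // d'; rewrite leq_exp2r.
  apply: leq_trans (leq_pexp2l _ ltds) => //.
  by rewrite expnMn expnS mulnC ltn_mul2r expn_gt0 /= ltnSn.
have [v v0 vA] := kermx_vector A ltGT.
pose c (e : T) := v 0 (enum_rank e).
exists (\sum_e c e *: power_prod e).
  apply: collapse_power_prod; apply/existsP; case/rV0Pn: v0 => r vr.
  by exists (enum_val r); rewrite /c enum_valK.
move=> m mF; rewrite raddf_sum /=.
have [/forallP ltm|] := boolP [forall i, (m i < K)%N]; last first.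
  case/forallPn => i; rewrite -leqNgt => leK; rewrite big1 // => e _.
  rewrite mcoeffZ memN_msupp_eq0 ?mulr0 //; apply: msize_mdeg_ge.
  apply: leq_trans (msize_power_prod e sD) _; apply: leq_trans leK _.
  by rewrite mdegE (bigD1 i) //= leq_addr.
pose g : G := [ffun u => Ordinal (ltm (val u))].
have -> : m = mon g.
  apply/mnmP => i; rewrite mnmE; case: insubP => [u _ <-|niF]; first by rewrite ffunE.
  by apply/eqP; apply: contraNT niF => mi; apply: (subsetP mF); rewrite inE.
have /rowP/(_ (enum_rank g)) := vA; rewrite !mxE => vAg.
rewrite -[RHS]vAg (reindex (enum_val : 'I_#|T| -> T)) /=; last first.
  exact: onW_bij (enum_val_bij _).
by apply: eq_bigr => r _; rewrite mcoeffZ /c enum_valK mxE enum_rankK.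
Qed.

End Relations.

(** * Clean filtrations of monomial ideals *)

Section UpSets.

Variable n : nat.
Implicit Types (U : {set {set 'I_n}}) (A B F R V : {set 'I_n}).

Definition upset U : Prop := forall A B, A \in U -> A \subset B -> B \in U.

Definition up R : {set {set 'I_n}} := [set A : {set 'I_n} | R \subset A].

Definition nonfaces F : {set {set 'I_n}} := [set A : {set 'I_n} | ~~ (A \subset F)].

Lemma upsetU U R : upset U -> upset (U :|: up R).
Proof.
move=> upU A B; rewrite !inE => /orP[UA|sRA] sAB; first by rewrite (upU A B).
by rewrite (subset_trans sRA sAB) orbT.
Qed.

Lemma upset_nonfaces F : upset (nonfaces F).
Proof.
by move=> A B; rewrite !inE => + sAB; apply: contra => /(subset_trans sAB).
Qed.

(* For the monomial ideals spanned by the two families: a filtration of the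
   quotient by copies of the rings k[x_i : i in F] with #|F| = d, generated by the
   products of the variables in R.  The vertex set [V] only serves the induction
   on the number of vertices. *)
Inductive clean V (d : nat) U : {set {set 'I_n}} -> Prop :=
| clean_refl : clean V d U U
| clean_step R F U' of #|F| = d & R \subset V & R \subset F
    & (forall A : {set 'I_n}, R \subset A -> (A \notin U) = (A \subset F))
    & clean V d (U :|: up R) U' : clean V d U U'.

Lemma clean_sub V d U U' : clean V d U U' -> U \subset U'.
Proof. by elim=> // {}U R F {}U' _ _ _ _ _; apply/subset_trans/subsetUl. Qed.

Lemma clean_upset V d U U' : upset U -> clean V d U U' -> upset U'.
Proof. by move=> + cU; elim: cU => // {}U R F {}U' _ _ _ _ _ IH upU; apply/IH/upsetU. Qed.

(* For A = F, the family on the left is the complement of the boundary complex of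
   the simplex on [F]. *)
Lemma clean_boundary V d F A : #|F| = d.+1 -> A \subset F -> F \subset V ->
  clean V d (nonfaces F :|: up A) setT.
Proof.
move=> cardF + sFV; move: {2}#|A| (erefl #|A|) => m; elim: m A => [|m IHm] A cardA sAF.
  have -> : nonfaces F :|: up A = setT; last exact: clean_refl.
  by apply/setP=> B; rewrite !inE (cards0_eq cardA) sub0set orbT.
have /card_gt0P[j Aj] : (0 < #|A|)%N by rewrite cardA.
have sA'F : A :\ j \subset F by apply: subset_trans sAF; apply: subsetDl.
(* A set containing A minus j escapes the family exactly when it lies in F and avoids j; after this
   step A has lost the vertex j. *)
apply: (@clean_step _ _ _ (A :\ j) (F :\ j)).
- by have := cardsD1 j F; rewrite cardF (subsetP sAF) // add1n => -[].
- exact: subset_trans sFV.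
- exact: setSD.
- move=> B sA'B; rewrite !inE negb_or negbK subsetD1; congr (_ && _).
  rewrite -(setD1K Aj) subUset sub1set sA'B andbT //.
suff -> : nonfaces F :|: up A :|: up (A :\ j) = nonfaces F :|: up (A :\ j).
  apply: IHm => //; have := cardsD1 j A; rewrite cardA Aj add1n => -[<-] //.
apply/setP=> B; rewrite !inE -orbA; congr (_ || _); apply/orb_idl.
exact/subset_trans/subsetDl.
Qed.

End UpSets.

Arguments upset_nonfaces {n} F A B _ _.

(** * Monomial ideals attached to up-sets *)

Section MonomialIdeals.

Variables (k : fieldType) (n : nat).
Local Notation S := {mpoly k[n]}.
Implicit Types (U : {set {set 'I_n}}) (A B F R V : {set 'I_n}) (p : S).

Definition mono_ideal U : {pred S} :=
  [pred p : S | all (fun m => msupport m \in U) (msupp p)].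

Definition in_mono U : S^o -> Prop := fun p => (p : S) \in mono_ideal U.

Lemma mono_idealP U p :
  reflect (forall m, p@_m != 0 -> msupport m \in U) (p \in mono_ideal U).
Proof.
by apply: (iffP allP) => Up m; have := Up m; rewrite mcoeff_msupp.
Qed.

Lemma msupportD m1 m2 :
  msupport (m1 + m2 : 'X_{1..n}) = msupport m1 :|: msupport m2.
Proof. by apply/setP=> i; rewrite !inE mnmDE addn_eq0 negb_and. Qed.

Lemma msupport0 : msupport (0 : 'X_{1..n}) = set0.
Proof. by apply/setP=> i; rewrite !inE mnm0E. Qed.

Lemma msupport_mesym1 R : msupport (mesym1 R) = R.
Proof. by apply/setP=> i; rewrite !inE mnmE; case: (i \in R). Qed.

Lemma xmonE R : xmon k R = 'X_[mesym1 R].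
Proof.
rewrite /xmon mprodXE; congr 'X_[_].
apply/mnmP=> i; rewrite mnmE mnm_sumE big_mkcond /=.
rewrite (bigD1 i) //= mnmE eqxx /= big1 ?addn0 // => j ne_ji.
by case: (_ \in _); rewrite // mnmE (negbTE ne_ji).
Qed.

Lemma mono_ideal_submodule U : upset U -> submodule (in_mono U).
Proof.
move=> upU; split=> [|a x y /mono_idealP Ux /mono_idealP Uy].
  by apply/mono_idealP => m; rewrite mcoeff0 eqxx.
apply/mono_idealP => m; rewrite mcoeffB.
have [xm|/Ux //] := eqVneq ((x : S)@_m) 0; rewrite xm sub0r oppr_eq0 -mcoeff_msupp.
case/msuppM_le/allpairsP=> -[m1 m2] [/= _ ym2 ->]; rewrite msupportD.
by apply: upU (subsetUr _ _); apply: Uy; rewrite -mcoeff_msupp.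
Qed.

Lemma mem_mono_idealX U m : ('X_[m] \in mono_ideal U) = (msupport m \in U).
Proof. by rewrite inE msuppX /= andbT. Qed.

Lemma mono_ideal_ind U (Q : S^o -> Prop) : submodule Q ->
  (forall m, msupport m \in U -> Q 'X_[m]) -> forall p, in_mono U p -> Q p.
Proof.
move=> sQ QX p /allP Up; rewrite /= -[p]/(p : S) (mpolyE p).
rewrite big_seq; elim/big_ind: _ => [|x y|m /Up Um]; first exact: (submodule0 sQ).
  exact: (submoduleD sQ).
by rewrite -mul_mpolyC; apply: (submoduleZ _ sQ); apply: QX.
Qed.

Lemma mono_ideal_sub U U' p : U \subset U' -> in_mono U p -> in_mono U' p.
Proof. by move=> /subsetP sUU' /allP Up; apply/allP => m /Up /sUU'. Qed.

Lemma mem_mono_idealM U R p :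
  (p * xmon k R \in mono_ideal U) = all (fun m => R :|: msupport m \in U) (msupp p).
Proof.
rewrite inE xmonE (perm_all _ (msuppMX p _)) all_map; apply: eq_all => m /=.
by rewrite msupportD msupport_mesym1.
Qed.

(** Computes the colon ideal I_U : x_R as the face prime P_F. The support of m x_R contains R, so it
    misses U exactly when it lies in F, that is, when the support of m does. *)
Lemma colon_mono_ideal U R F p : R \subset F ->
  (forall A, R \subset A -> (A \notin U) = (A \subset F)) ->
  in_mono (nonfaces F) p <-> in_mono U (p * xmon k R).
Proof.
move=> sRF UF; rewrite /in_mono.
suff -> : (p \in mono_ideal (nonfaces F)) = (p * xmon k R \in mono_ideal U) by [].
rewrite mem_mono_idealM inE; apply: eq_all => m /=; apply: negb_inj.
by rewrite !inE negbK (UF _ (subsetUl _ _)) subUset sRF.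
Qed.

Lemma mono_idealUP U R p : upset U ->
  in_mono (U :|: up R) p <-> exists b, in_mono U (p - b * xmon k R).
Proof.
move=> upU; have sU := mono_ideal_submodule upU; split=> [|[b Upb]].
  move: p; apply: mono_ideal_ind => [|m].
    split=> [|a x y [b Ux] [c Uy]].
      by exists 0; rewrite mul0r subr0; exact: submodule0.
    exists (b - a * c).
    have -> : (x : S) - a * y - (b - a * c) * xmon k R =
      (x - b * xmon k R) - a * (y - c * xmon k R) by ring.
    exact: (submoduleBZ a sU).
  rewrite !inE => /orP[Um|sRm].
    by exists 0; rewrite mul0r subr0 /in_mono mem_mono_idealX.
  exists 'X_[m - mesym1 R]; rewrite xmonE -mpolyXD submK ?subrr.
    exact: submodule0 sU.
  apply/mnm_lepP => i; rewrite mnmE; have := subsetP sRm i; rewrite inE -lt0n.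
  by case: (i \in R) => // ->.
rewrite -[p](subrK (b * xmon k R)); have sU' := mono_ideal_submodule (upsetU (R := R) upU).
apply: (submoduleD sU'); first by apply: mono_ideal_sub Upb; exact: subsetUl.
apply: (submoduleZ b sU'); rewrite /in_mono xmonE mem_mono_idealX.
by rewrite msupport_mesym1 !inE subxx orbT.
Qed.

(** The larger ideal is I_U + (x_R), and I_U : x_R = P_F; so multiplication by x_R identifies S /
    P_F with the factor of one clean step. *)
Lemma pair_iso_step U R F : upset U -> R \subset F ->
  (forall A, R \subset A -> (A \notin U) = (A \subset F)) ->
  pair_iso (V := S^o) (W := S^o) (fun=> True) (in_mono (nonfaces F))
    (in_mono (U :|: up R)) (in_mono U) (fun b : S => b * xmon k R).
Proof.
move=> upU sRF UF; have sU := mono_ideal_submodule upU.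
split=> [a x y _ _|x _|y|x _]; first by rewrite mulrBl -mulrA.
- by apply/mono_idealUP => //; exists x; rewrite subrr; exact: submodule0 sU.
- by case/mono_idealUP=> // b Uy; exists b.
- exact: colon_mono_ideal.
Qed.

Fixpoint esyms (d : nat) : seq S :=
  if d is d'.+1 then mesym n k d :: esyms d' else [::].

(** Every other term of the symmetric polynomial is a product over a set as large as F but different
    from it, hence not contained in F. *)
Lemma mesym_mod F : in_mono (nonfaces F) (mesym n k #|F| - xmon k F).
Proof.
rewrite /mesym (bigD1 F) //= addrAC subrr add0r.
have sF := mono_ideal_submodule (upset_nonfaces F).
elim/big_ind: _ => [|x y|A /andP[/eqP cardA neAF]]; first exact: submodule0 sF.
  exact: submoduleD sF.
rewrite -[X in in_mono _ X]/(xmon k A) xmonE /in_mono mem_mono_idealX msupport_mesym1 inE.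
by apply: contra neAF => sAF; rewrite eqEcard sAF cardA /=.
Qed.

Lemma in_mono_setT p : in_mono setT p.
Proof. by apply/allP => m _; rewrite inE. Qed.

(* Modulo P_F with #|F| = d, the elementary symmetric polynomial e_d becomes the
   product of the variables in [F], so e_d is regular on k[x_i : i in F] and the
   quotient is the Stanley-Reisner ring of the boundary of a simplex. *)
Lemma clean_wreg V d U U' : upset U -> clean V d U U' ->
  wreg (V := S^o) (esyms d) (in_mono U') (in_mono U).
Proof.
elim: d V U U' => [//|d IHd] V U U' upU cU.
have sT : submodule (fun _ : S^o => True) by [].
have base F : #|F| = d.+1 ->
    wreg (V := S^o) (esyms d.+1) (fun=> True) (in_mono (nonfaces F)).
  move=> cardF; have sF := mono_ideal_submodule (upset_nonfaces F).
  have eF : in_mono (nonfaces F) (mesym n k d.+1 - xmon k F).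
    by rewrite -cardF; exact: mesym_mod.
  split=> [x _ ex|].
    apply/(@colon_mono_ideal (nonfaces F) F F) => //.
      by move=> A _; rewrite inE negbK.
    have -> : (x : S) * xmon k F = mesym n k d.+1 * x - x * (mesym n k d.+1 - xmon k F).
      by ring.
    exact: (submoduleBZ (V := S^o)).
  (* Modulo P_F the polynomials e_(d+1) and x_F agree, so the quotient is the boundary ring, which
     is clean in dimension d; the induction on d treats the remaining sequence. *)
  have cb := clean_boundary cardF (subxx F) (subsetT F).
  have upb := upsetU (R := F) (upset_nonfaces F).
  apply: eq_wreg (IHd _ _ _ upb cb) => x; first by split=> // _; exact: in_mono_setT.
  split=> [/(mono_idealUP _ _ (upset_nonfaces F))[b Fb]|[b _ Fb]].
    exists b => //; have -> : x - mesym n k d.+1 *: (b : S^o) =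
      (x : S) - b * xmon k F - b * (mesym n k d.+1 - xmon k F).
      by rewrite /GRing.scale /=; ring.
    exact: (submoduleBZ (V := S^o)).
  apply/(mono_idealUP _ _ (upset_nonfaces F)); exists b.
  have -> : (x : S) - b * xmon k F =
     x - mesym n k d.+1 *: (b : S^o) + b * (mesym n k d.+1 - xmon k F).
    by rewrite /GRing.scale /=; ring.
  by apply: (submoduleD (V := S^o)) => //; apply: (submoduleZ (V := S^o)).
elim: cU upU => {U U'} [U|U R F U' cardF _ sRF UF cU IH] upU.
  exact: wreg_trivial (mono_ideal_submodule upU) _.
have upUR := upsetU (R := R) upU.
apply: (wreg_ext (N1 := in_mono (U :|: up R))).
- exact: mono_ideal_submodule.
- exact: mono_ideal_submodule.
- exact/mono_ideal_submodule/(clean_upset upUR cU).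
- by move=> x; apply/mono_ideal_sub/subsetUl.
- by move=> x; apply/mono_ideal_sub/(clean_sub cU).
- apply: (wreg_iso _ _ _ _ _ (pair_iso_step upU sRF UF)).1 (base F cardF) => //;
    exact/mono_ideal_submodule/upset_nonfaces || exact: mono_ideal_submodule.
- exact: IH.
Qed.

(** Each clean step has its own relation modulo P_F. Their product still collapses, and it pushes
    I_U' down the filtration into I_U. *)
Lemma clean_collapse V d U U' (s : seq S) : upset U -> clean V d U U' -> (d < size s)%N ->
  exists2 a, collapse s a & forall p, in_mono U' p -> in_mono U (a * p).
Proof.
move=> upU cU szs; elim: cU upU => {U U'} [U|U R F U' cardF _ sRF UF cU IH] upU.
  have [a ca] := collapse_exists s; exists a => // p.
  exact: (submoduleZ a (mono_ideal_submodule upU)).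
have [a ca aU'] := IH (upsetU upU).
have [b cb bF] : exists2 b, collapse s b & forall m, msupport m \subset F -> b@_m = 0.
  by apply: exists_collapse; rewrite cardF.
exists (b * a); first exact: collapseM.
move=> p /aU'; rewrite -mulrA; set q := a * p => /(mono_idealUP _ _ upU)[c Uqc].
have Fb : in_mono (nonfaces F) (c * b).
  apply: (submoduleZ c (mono_ideal_submodule (upset_nonfaces F))).
  by apply/mono_idealP => m; rewrite inE; apply: contra => /bF->.
have -> : b * q = b * (q - c * xmon k R) + c * b * xmon k R by ring.
have sU := mono_ideal_submodule upU.
apply: (submoduleD sU); first exact: submoduleZ sU Uqc.
exact/(colon_mono_ideal _ sRF UF).
Qed.

Lemma clean_ann V d U U' : clean V d U U' -> U != U' ->
  exists2 F : {set 'I_n}, #|F| = d & forall a,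
    (forall p, in_mono U' p -> in_mono U (a * p)) -> in_mono (nonfaces F) a.
Proof.
case=> [|R F {}U' cardF _ sRF UF cU _]; first by rewrite eqxx.
exists F => // a aU; apply/(colon_mono_ideal _ sRF UF); apply: aU.
rewrite /in_mono xmonE mem_mono_idealX msupport_mesym1.
by apply: (subsetP (clean_sub cU)); rewrite !inE subxx orbT.
Qed.

Lemma addmuls_irrelevant F (s : seq S) : (forall p, p \in s -> in_irrelevant p) ->
  ~ addmuls (V := S^o) s (fun=> True) (in_mono (nonfaces F)) 1.
Proof.
move=> s0 /addmulsP[]// y _ /mono_idealP/(_ 0%MM).
rewrite msupport0 inE sub0set => /contraFeq; move=> /(_ erefl) /eqP.
rewrite mcoeffB mcoeff1 eqxx raddf_sum /= big1 ?subr0 ?oner_eq0 // => i _.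
rewrite -[_ *: y i]/(s`_i * (y i : S)) rmorphM /=.
by have /s0 := mem_nth 0 (ltn_ord i); rewrite /in_irrelevant => ->; rewrite mul0r.
Qed.

(** The last nonzero factor is a quotient of I_U' / I_U isomorphic to S / P_F; polynomials without
    constant term never reach its generator. *)
Lemma clean_nontrivial V d U U' : upset U -> clean V d U U' -> U != U' ->
  exists2 x, in_mono U' x & forall s : seq S, (forall p, p \in s -> in_irrelevant p) ->
    ~ addmuls (V := S^o) s (in_mono U') (in_mono U) x.
Proof.
move=> + cU; elim: cU => {U U'} [U|U R F U' cardF _ sRF UF cU IH] upU neU.
  by rewrite eqxx in neU.
have upUR := upsetU (R := R) upU.
have [eqU'|neU'] := eqVneq (U :|: up R) U'; last first.
  have [x U'x nx] := IH upUR neU'; exists x => // s /nx nsx sU; apply: nsx.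
  by apply: addmuls_mono sU => // y; apply/mono_ideal_sub/subsetUl.
have iso := pair_iso_step upU sRF UF.
rewrite -eqU'; exists (1 * xmon k R).
  by case: iso => _ iso _ _; apply: iso.
move=> s s0 sU; apply: (addmuls_irrelevant s0 (F := F)).
have sF := mono_ideal_submodule (upset_nonfaces F).
have sU' := mono_ideal_submodule upUR.
by apply: (addmuls_iso s _ sF sU' (mono_ideal_submodule upU) iso I).2.
Qed.

End MonomialIdeals.

(** * Face primes and chains of primes *)

Section FacePrimes.

Variables (k : fieldType) (n : nat).
Local Notation S := {mpoly k[n]}.
Implicit Types (F : {set 'I_n}).

(** Sets the variables outside F to zero. Its kernel is P_F, which is therefore prime, as S is a
    domain. *)
Definition face_restriction F (p : S) : S :=
  p \mPo [tuple if i \in F then 'X_i else 0 | i < n].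

Lemma face_restrictionX F m :
  face_restriction F 'X_[m] = if msupport m \subset F then 'X_[m] else 0.
Proof.
rewrite /face_restriction comp_mpolyX; case: ifPn => [/subsetP mF|/subsetPn[i mi nFi]].
  rewrite [RHS]mpolyXE_id; apply: eq_bigr => i _; rewrite tnth_mktuple.
  case: ifPn => // nFi; have [->|mi] := eqVneq (m i) 0%N; first by rewrite !expr0.
  by have := mF i; rewrite inE mi (negPf nFi) => /(_ isT).
rewrite (bigD1 i) //= tnth_mktuple (negPf nFi) expr0n.
by move: mi; rewrite inE => /negPf->; rewrite mul0r.
Qed.

Lemma face_restriction_eq0 F (p : S) :
  (p \in mono_ideal (nonfaces F)) = (face_restriction F p == 0).
Proof.
have sF := mono_ideal_submodule k (upset_nonfaces F).
apply/idP/eqP => [|rp0].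
  move: p; apply: (mono_ideal_ind (Q := fun p => face_restriction F p = 0)) => [|m].
    split=> [|a x y x0 y0]; first exact: raddf0.
    rewrite /face_restriction raddfB /= -[a *: y]/(a * (y : S)) rmorphM /=.
    by rewrite [x \mPo _]x0 [y \mPo _]y0 mulr0 subr0.
  by rewrite inE face_restrictionX => /negPf->.
rewrite -[p]subr0 -[X in _ - X]rp0.
rewrite [p in p - _]mpolyE /face_restriction comp_mpolyEX -sumrB.
elim/big_ind: _ => [|x y|m _]; [exact: submodule0 sF|exact: submoduleD sF|].
rewrite -scalerBr -mul_mpolyC; apply: (submoduleZ _ sF).
rewrite -[_ \mPo _]/(face_restriction F 'X_[m]) face_restrictionX.
case: ifPn => mF; first by rewrite subrr; exact: submodule0 sF.
by rewrite subr0 /in_mono mem_mono_idealX inE.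
Qed.

Definition face_ideal F : {pred S} := mono_ideal (nonfaces F).

Lemma face_ideal_idealr F : idealr_closed (face_ideal F).
Proof.
have sF := mono_ideal_submodule k (upset_nonfaces F).
split=> [||a u v Fu Fv]; first exact: submodule0 sF.
  by rewrite -mpolyX0 /face_ideal mem_mono_idealX msupport0 inE sub0set.
by apply: (submoduleD sF) => //; apply: (submoduleZ a sF).
Qed.

HB.instance Definition _ F := isIdealr.Build S (face_ideal F) (face_ideal_idealr F).

Lemma face_ideal_prime F : prime_idealr_closed (face_ideal F).
Proof.
move=> u v; rewrite /face_ideal !face_restriction_eq0 /face_restriction rmorphM /=.
by rewrite mulf_eq0.
Qed.

HB.instance Definition _ F :=
  isPrimeIdealrClosed.Build S (face_ideal F) (@face_ideal_prime F).

(** Removing the vertices of F one at a time enlarges P_F strictly, since the variable of the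
    removed vertex enters. *)
Lemma face_ideal_prime_chain (M : lmodType S) F :
  (forall a, in_ann M a -> a \in face_ideal F) -> has_prime_chain M #|F|.
Proof.
move=> annF; pose G i := [set x in drop i (enum F)].
exists (fun i => face_ideal (G i) : prime_idealr S); split=> [a /annF|i lti].
  suff -> : G 0%N = F by [].
  by apply/setP=> x; rewrite inE drop0 mem_enum.
have ltiF : (i < size (enum F))%N by rewrite -cardE.
case E : (enum F) ltiF => [//|x0 s0]; rewrite -{}E => ltiF.
have dropi : drop i (enum F) = nth x0 (enum F) i :: drop i.+1 (enum F) by exact: drop_nth.
split=> [p|sub].
  move/mono_idealP=> pi; apply/mono_idealP => m /pi; rewrite !inE; apply: contra.
  move/subset_trans; apply; apply/subsetP => x; rewrite !inE dropi => xd.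
  by rewrite in_cons xd orbT.
pose x := nth x0 (enum F) i.
have /(sub _) : 'X_x \in face_ideal (G i.+1).
  rewrite /face_ideal mem_mono_idealX inE; apply/subsetPn; exists x.
    by rewrite inE mnmE eqxx.
  by have := drop_uniq i (enum_uniq F); rewrite dropi inE /= => /andP[].
rewrite /face_ideal mem_mono_idealX inE => /negP; apply; apply/subsetP => y.
by rewrite inE mnmE; case: (x =P y) => // <- _; rewrite inE dropi mem_head.
Qed.

(** In a longer chain, choose x_i in P (i+1) outside P i. These collapse to an annihilator, which
    lies in P 0, against [collapse_chain]. *)
Lemma prime_chain_bound (M : lmodType S) d e :
  (forall s : seq S, (d < size s)%N -> exists2 a, collapse s a & in_ann M a) ->
  has_prime_chain M e -> (e <= d)%N.
Proof.
move=> cM [P [annP chP]]; rewrite leqNgt; apply/negP => ltde.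
have /choice[x xP] : forall i, exists x : S, (i < e)%N -> x \in P i.+1 /\ x \notin P i.
  move=> i; case: (ltnP i e) => [lti|]; last by exists 0.
  have [_ /existsNP[x /not_implyP[Px /negP nPx]]] := chP i lti.
  by exists x.
have [|a ca /annP aP] := cM (mkseq x d.+1); first by rewrite size_mkseq.
suff /(_ ca)/negP : collapse (mkseq x d.+1) a -> a \notin P 0%N by [].
apply: collapse_chain => i; rewrite size_mkseq => lti.
have ltie := leq_trans lti ltde.
by have [sP _] := chP i ltie; have [Px nPx] := xP i ltie; rewrite nth_mkseq.
Qed.

End FacePrimes.

Lemma mesym_irrelevant (k : fieldType) n d : in_irrelevant (mesym n k d.+1).
Proof.
rewrite /in_irrelevant /mesym raddf_sum big1 //= => A /eqP cardA.
have /card_gt0P[i Ai] : (0 < #|A|)%N by rewrite cardA.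
rewrite rmorph_prod (bigD1 i) //= mcoeffX.
case: eqP => [/mnmP/(_ i)|]; last by rewrite mul0r.
by rewrite mnmE eqxx mnm0E.
Qed.

Lemma esyms_irrelevant (k : fieldType) n d p : p \in esyms k n d -> in_irrelevant p.
Proof.
elim: d => //= d IHd; rewrite inE => /orP[/eqP->|/IHd//].
exact: mesym_irrelevant.
Qed.

(** * From clean filtrations to Cohen--Macaulay modules *)

Section CohenMacaulay.

Variables (k : fieldType) (n : nat).
Local Notation S := {mpoly k[n]}.
Variable M : lmodType S.

Lemma regular_seqP (s : seq S) : regular_seq M s <->
  wreg s (fun _ : M => True) (fun x => x = 0) /\
  exists x : M, ~ addmuls s (fun=> True) (fun x => x = 0) x.
Proof.
have mulP t x : in_mulmod t x <-> addmuls t (fun=> True) (fun x : M => x = 0) x.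
  split=> [[y ->]|/addmulsP[]// y _ /subr0_eq ->]; last by exists y.
  by apply/addmulsP => //; exists y => //; rewrite subrr.
split=> -[rs [x nx]]; split; try by exists x => /mulP.
  by apply/wregP => i lti y _ /mulP H; apply/mulP/rs.
by move=> i lti y /mulP H; apply/mulP; move/wregP: rs; apply.
Qed.

(** Collapsing elements in the annihilator bound both chains of primes and regular sequences by d; a
    chain of face primes and the elementary symmetric polynomials attain the bound. *)
Lemma clean_CM V d U U' (f : S^o -> M) : upset U -> clean V d U U' -> U != U' ->
  pair_iso (in_mono U') (in_mono U) (fun=> True) (fun x => x = 0) f ->
  cohen_macaulay M /\ krull_dim_is M d.
Proof.
move=> upU cU neU iso; have sU := mono_ideal_submodule k upU.
have sU' := mono_ideal_submodule k (clean_upset upU cU).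
have sT : submodule (fun _ : M => True) by [].
have s0 : submodule (fun x : M => x = 0).
  by split=> // a x y -> ->; rewrite scaler0 subr0.
have fZ a x : in_mono U' x -> f (a *: x) = a *: f x by move=> U'x; apply: pair_isoZ iso U'x.
have [_ fU' fsurj f0] := iso.
have annM a : in_ann M a <-> forall p, in_mono U' p -> in_mono U (a * p).
  split=> [aM p U'p|aU x].
    by apply/f0; [exact: (submoduleZ a sU')|rewrite [f _]fZ].
  have [p U'p /subr0_eq ->] := fsurj x I.
  by rewrite -fZ //; apply/f0; [exact: (submoduleZ a sU')|exact: aU].
have collM s : (d < size s)%N -> exists2 a, collapse s a & in_ann M a.
  by move=> /(clean_collapse upU cU)[a ca aU]; exists a => //; apply/annM.
have dimM : krull_dim_is M d.
  have [F cardF annF] := clean_ann k cU neU; split.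
    by rewrite -cardF; apply: face_ideal_prime_chain => a /annM/annF.
  by move=> e; apply: prime_chain_bound.
split=> //; exists d; split=> //; split.
  exists (esyms k n d); split.
    by elim: (d) => //= e ->.
    exact: esyms_irrelevant.
  apply/regular_seqP; split.
    by apply: (wreg_iso _ _ _ _ _ iso).1 (clean_wreg k upU cU).
  have [p U'p np] := clean_nontrivial k upU cU neU; exists (f p).
  move=> fs; apply: (np (esyms k n d)); first exact: esyms_irrelevant.
  by apply: (addmuls_iso _ sU' sU sT s0 iso U'p).2.
move=> e [s [<- _ /regular_seqP[rs [x nx]]]]; rewrite leqNgt; apply/negP => ltd.
have [a ca aM] := collM _ ltd; apply: nx.
by apply: collapse_wreg rs ca I (aM x).
Qed.

End CohenMacaulay.

(** * Shedding vertices of complexes defined by intervals *)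

Section Layers.

Local Open Scope nat_scope.

Variable n : nat.
Implicit Types (U : {set {set 'I_n}}) (A B C D F G R V e : {set 'I_n}).

Definition join (x : 'I_n) U U' : {set {set 'I_n}} :=
  [set A : {set 'I_n} | if x \in A then A \in U else A \in U'].

Lemma clean_weaken V V' d U U' : V \subset V' -> clean V d U U' -> clean V' d U U'.
Proof.
move=> sVV'; elim=> [{}U|{}U R F {}U' cardF sRV sRF UF _ IH]; first exact: clean_refl.
exact: clean_step (subset_trans sRV sVV') sRF UF IH.
Qed.

Lemma clean_trans V d U1 U2 U3 : clean V d U1 U2 -> clean V d U2 U3 -> clean V d U1 U3.
Proof.
elim=> // {}U1 R F {}U2 cardF sRV sRF UF _ IH cU3.
exact: clean_step cardF sRV sRF UF (IH cU3).
Qed.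

(** Membership in U ignores x, so each F contains x; replacing R by x |: R makes the step act only
    on sets through x. *)
Lemma clean_joinl x V d U U' U0 : x \notin V -> clean V d U U' ->
  (forall A, (x |: A \in U) = (A \in U)) -> clean (x |: V) d (join x U U0) (join x U' U0).
Proof.
move=> xV; elim=> [{}U|{}U R F {}U' cardF sRV sRF UF _ IH] Ux; first exact: clean_refl.
have xR : x \notin R by apply: contra xV; apply/subsetP.
have xRF : x |: R \subset F.
  by rewrite -(UF _ (subsetUr _ _)) Ux (UF _ (subxx _)).
apply: (@clean_step _ _ _ _ (x |: R) F) => //; first exact: setUS.
  move=> A; rewrite subUset sub1set => /andP[xA sRA].
  by rewrite inE xA UF.
have -> : join x U U0 :|: up (x |: R) = join x (U :|: up R) U0.
  apply/setP=> A; rewrite !inE subUset sub1set.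
  by case: (x \in A); rewrite ?orbF.
apply: IH => A; rewrite !inE Ux; congr (_ || _); apply/idP/idP => [/subsetP sR|sRA].
  apply/subsetP => y yR; have := sR y yR; rewrite !inE => /orP[/eqP eyx|//].
  by rewrite eyx (negPf xR) in yR.
by apply: subset_trans sRA (subsetUr _ _).
Qed.

(** Every set through x lies in U, so F avoids x; the sets through x above R are already in U0, so
    the same R and F work after gluing. *)
Lemma clean_joinr x V d U U' U0 : upset U0 -> clean V d U U' -> up [set x] \subset U ->
  (forall A, x \notin A -> A \in U' -> x |: A \in U0) ->
  clean V d (join x U0 U) (join x U0 U').
Proof.
move=> upU0; elim=> [{}U|{}U R F {}U' cardF sRV sRF UF cU IH] xU U'U0.
  exact: clean_refl.
have xF : x \notin F.
  have : F \notin U by rewrite UF.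
  by apply: contra => xF; apply: (subsetP xU); rewrite inE sub1set.
have xR : x \notin R by apply: contra xF; apply/subsetP.
have RU0 A : x \in A -> R \subset A -> A \in U0.
  move=> xA sRA; apply: (upU0 (x |: R)); last by rewrite subUset sub1set xA.
  by apply: U'U0 => //; apply: (subsetP (clean_sub cU)); rewrite !inE subxx orbT.
apply: (@clean_step _ _ _ _ R F) => // [A sRA|].
  rewrite inE; case: ifPn => [xA|_]; last exact: UF.
  by rewrite RU0 //; apply/esym/negbTE; apply: contra xF => /subsetP; apply.
have -> : join x U0 U :|: up R = join x U0 (U :|: up R).
  apply/setP=> A; rewrite !inE; case: ifP => // xA.
  by apply/orb_idr => /RU0->.
by apply: IH => //; apply: subset_trans xU (subsetUl _ _).
Qed.

(** For a complex U, the up-set behind one term of the dimension filtration. The strict bound makes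
    d = 0 give exactly the nonfaces, so passing from d to d + 1 adds the layer of dimension d. *)
Definition low U d : {set {set 'I_n}} :=
  [set A : {set 'I_n} | [forall F in U, (A \subset F) ==> (#|F| < d)]].

Lemma lowP U d A :
  reflect (forall F, F \in U -> A \subset F -> #|F| < d) (A \in low U d).
Proof. by rewrite inE; apply: (iffP forall_inP) => H F /H /implyP. Qed.

Lemma low_upset U d : upset (low U d).
Proof.
move=> A B /lowP lA sAB; apply/lowP => F UF sBF.
by apply: lA => //; apply: subset_trans sBF.
Qed.

Variable E : {set {set 'I_n}}.
Hypothesis E_convex : forall e, e \in E -> forall i j l : 'I_n,
  i \in e -> l \in e -> i <= j -> j <= l -> j \in e.

(* Iterated links (at the vertices of [C], which become cone points) and
   deletions (of the vertices of [D]) of the complex of the sets containing no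
   member of [E]. *)
Definition link_del C D : {set {set 'I_n}} :=
  [set A : {set 'I_n} | (A \subset ~: D) && ~~ [exists e in E, e \subset A :|: C]].

Lemma link_delP C D A :
  reflect ((A \subset ~: D) /\ forall e, e \in E -> ~~ (e \subset A :|: C))
          (A \in link_del C D).
Proof.
rewrite inE negb_exists_in.
by apply: (iffP andP) => -[dAD /forall_inP EA].
Qed.

Lemma link_del_link x C D A : x \in A ->
  (A \in link_del (x |: C) D) = (A \in link_del C D).
Proof.
move=> xA; rewrite !inE; suff -> : A :|: (x |: C) = A :|: C by [].
by rewrite setUA; congr (_ :|: _); apply/setUidPl; rewrite sub1set.
Qed.

Lemma link_del_cone x C D A : x \notin D ->
  (x |: A \in link_del (x |: C) D) = (A \in link_del (x |: C) D).
Proof.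
move=> xD; rewrite !inE subUset sub1set inE xD /=; congr (_ && ~~ _).
by rewrite setUACA setUid setUCA.
Qed.

Lemma link_del_del x C D A :
  (A \in link_del C (x |: D)) = (x \notin A) && (A \in link_del C D).
Proof. by rewrite !inE setCU setIC -setDE subsetD1 (andbC (A \subset _)) andbA. Qed.

(** * Gluing at a shedding vertex *)

Section Shedding.

Variables (x : 'I_n) (C D : {set 'I_n}) (f : {set 'I_n}).
Hypotheses (dCD : (C \subset ~: D)) (Ef : f \in E) (dfD : (f \subset ~: D))
  (xf : x \in f) (xC : x \notin C)
  (max_f : forall y, y \in f -> y \notin C -> y <= x)
  (min_x : forall e, e \in E -> (e \subset ~: D) ->
     exists z, [/\ z \in e, z \notin C & x <= z]).

(* Some y in [f] is missing from x |: G; any e in E with e \subset y |: G :|: C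
   contains y and a vertex beyond x, hence x by convexity. *)
Lemma shedding G : x \notin G -> x |: G \in link_del C D ->
  exists2 y, y \notin x |: G & y |: G \in link_del C D.
Proof.
move=> xG /link_delP[dxG nE].
have /subsetPn[y yf] := nE f Ef; rewrite inE negb_or => /andP[yxG yC].
exists y => //; apply/link_delP.
have yD : y \in ~: D by rewrite (subsetP dfD).
have dG : (G \subset ~: D) by apply: subset_trans dxG; apply: subsetUr.
have dyG : (y |: G \subset ~: D) by rewrite subUset sub1set yD.
split=> // e Ee; apply/negP => /subsetP se.
have deD : (e \subset ~: D).
  apply: (@subset_trans _ _ (mem (y |: G :|: C))); first exact/subsetP.
  by rewrite subUset dyG dCD.
have ye : y \in e.
  apply: contraR (nE e Ee) => ye; apply/subsetP => z ze.
  have := se z ze; rewrite !inE -!orbA => /or3P[/eqP zy|->|->]; rewrite ?orbT //.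
  by rewrite -zy ze in ye.
have [z [ze zC lexz]] := min_x Ee deD.
have := se x (E_convex Ee ye ze (max_f yf yC) lexz).
rewrite !inE (negPf xG) (negPf xC) !orbF => /eqP exy.
by rewrite -exy !inE eqxx in yxG.
Qed.

Let xD : x \notin D. Proof. by have := subsetP dfD _ xf; rewrite inE. Qed.

Lemma low_cone d A :
  (x |: A \in low (link_del (x |: C) D) d) = (A \in low (link_del (x |: C) D) d).
Proof.
apply/idP/idP => [/lowP lA|]; last by move/low_upset; apply; apply: subsetUr.
apply/lowP => F DF sAF; apply: leq_ltn_trans (subset_leq_card (subsetUr [set x] F)) _.
by apply: lA; [rewrite link_del_cone | exact: setUS].
Qed.

(** If A avoids x, faces through x above A are controlled by the deletion: [shedding] exchanges x
    for some y, giving a face of the deletion of the same size that still contains A. *)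
Lemma low_link_del d :
  low (link_del C D) d =
  join x (low (link_del (x |: C) D) d) (low (link_del C (x |: D)) d).
Proof.
apply/setP=> A; rewrite [in RHS]inE; case: ifPn => xA.
  apply/lowP/lowP => lA F DF sAF; apply: lA => //; move: DF;
    by rewrite link_del_link // (subsetP sAF).
apply/lowP/lowP => lA F DF sAF.
  by apply: lA => //; move: DF; rewrite link_del_del => /andP[].
have [xF|xF] := boolP (x \in F); last by apply: lA => //; rewrite link_del_del xF.
have [||y] := @shedding (F :\ x); rewrite ?setD1K ?setD11 // => yF DyF.
have xy : x != y by apply: contraNneq yF => <-.
have <- : #|y |: F :\ x| = #|F|.
  by rewrite cardsU1 (cardsD1 x F) xF !inE negb_and yF orbT.
apply: lA; first by rewrite link_del_del DyF !inE (negPf xy) eqxx.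
apply/subsetP => z zA; rewrite !inE (subsetP sAF) // andbT orbC.
by apply/orP; left; apply: contraNneq xA => <-.
Qed.

(** The layer is climbed in two stages: first the link part, on sets through x, then the deletion
    part, on the others. *)
Lemma clean_shedding d :
  clean (~: (x |: C :|: D)) d (low (link_del (x |: C) D) d)
    (low (link_del (x |: C) D) d.+1) ->
  clean (~: (C :|: (x |: D))) d (low (link_del C (x |: D)) d)
    (low (link_del C (x |: D)) d.+1) ->
  clean (~: (C :|: D)) d (low (link_del C D) d) (low (link_del C D) d.+1).
Proof.
move=> cl cd; rewrite !low_link_del.
apply: (@clean_trans _ _ _
  (join x (low (link_del (x |: C) D) d.+1) (low (link_del C (x |: D)) d))).
  apply: (@clean_weaken (x |: ~: (x |: C :|: D))).
    apply/subsetP => z; rewrite !inE; case: eqP => [-> _|_].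
      by rewrite negb_or xC.
    by [].
  apply: clean_joinl cl _ => [|A]; last exact: low_cone.
  by rewrite !inE eqxx.
apply: clean_joinr; first exact: low_upset.
- by apply: clean_weaken cd; rewrite setCS setUCA subsetUr.
- apply/subsetP => A; rewrite inE sub1set => xA; apply/lowP => F.
  by rewrite link_del_del => /andP[+ _] /subsetP sAF; rewrite sAF.
(* Compatibility of the two parts: A is low in the whole complex, hence so is x |: A, which the link
   part judges. *)
move=> A xA lA; have : A \in low (link_del C D) d.+1 by rewrite low_link_del inE (negPf xA).
by move/low_upset/(_ (subsetUr [set x] A)); rewrite low_link_del inE setU11.
Qed.

End Shedding.

(** Induction on the number of vertices outside C and D. Either a member of E lies in C and the
    complex is void, or a member avoids D and the least right end is shed, or the complex is the
    full simplex on the complement of D. *)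
Lemma clean_link_del C D d : C \subset ~: D ->
  clean (~: (C :|: D)) d (low (link_del C D) d) (low (link_del C D) d.+1).
Proof.
move: {2}#|_|.+1 (ltnSn #|~: (C :|: D)|) => m.
elim: m C D => // m IHm C D ltm sCD.
have [/existsP[e /andP[Ee seC]]|/existsPn nEC] := boolP [exists e in E, e \subset C].
  have lowT d' : low (link_del C D) d' = setT.
    apply/setP=> A; rewrite [RHS]inE; apply/lowP => F /link_delP[_ /(_ e Ee)].
    by rewrite (subset_trans seC) // subsetUr.
  by rewrite !lowT; apply: clean_refl.
have nsC e : e \in E -> ~~ (e \subset C) by move=> Ee; have := nEC e; rewrite Ee.
(* Right ends are taken outside C, whose vertices are cone points. *)
pose P x := [exists f in E, [&& f \subset ~: D, x \in f, x \notin C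
             & [forall y in f, (y \notin C) ==> (y <= x)]]].
have Pmax f : f \in E -> f \subset ~: D -> exists2 x, P x & x \in f :\: C.
  move=> Ef fD; have /subsetPn[y yf yC] := nsC f Ef.
  have y0 : y \in f :\: C by rewrite inE yC.
  case: (arg_maxnP (fun z : 'I_n => z : nat) y0) => x xfC maxx; exists x => //.
  have /setDP[xf xC] := xfC.
  apply/existsP; exists f; rewrite Ef fD xf xC /=; apply/forall_inP => z zf.
  by apply/implyP => zC; apply: maxx; apply/setDP.
have [/existsP[f0 /andP[Ef0 fD0]]|/existsPn nED] := boolP [exists f in E, f \subset ~: D].
  have [x0 Px0 _] := Pmax f0 Ef0 fD0.
  case: (arg_minnP (fun z : 'I_n => z : nat) Px0) => x /existsP[f /andP[Ef]].
  case/and4P=> fD xf xC /forall_inP maxf minx.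
  have xD : x \notin D by have := subsetP fD x xf; rewrite inE.
  have xV : x \in ~: (C :|: D) by rewrite !inE negb_or xC.
  apply: (@clean_shedding x C D f) => //.
  - by move=> y yf; apply/implyP/maxf.
  - move=> e Ee eD; have [z Pz] := Pmax e Ee eD; rewrite inE => /andP[zC ze].
    by exists z; split=> //; apply: minx.
  - apply: IHm; last by rewrite subUset sub1set inE xD.
    rewrite -ltnS; apply: leq_trans ltm; rewrite ltnS; apply: proper_card.
    apply/properP; split; first by rewrite setCS -setUA subsetUr.
    by exists x; rewrite // !inE eqxx.
  apply: IHm; last by rewrite setCU setIC -setDE subsetD1 sCD.
  rewrite -ltnS; apply: leq_trans ltm; rewrite ltnS; apply: proper_card.
  apply/properP; split; first by rewrite setCS setUCA subsetUr.
  by exists x; rewrite // !inE eqxx orbT.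
have DE A : (A \in link_del C D) = (A \subset ~: D).
  rewrite inE andb_idr // => AD; rewrite negb_exists_in; apply/forall_inP => e Ee.
  have := nED e; rewrite Ee /=; apply: contra => /subset_trans; apply.
  by rewrite subUset AD.
have lowE d' A : (A \in low (link_del C D) d') = (A \subset ~: D) ==> (#|~: D| < d').
  apply/lowP/implyP => [lA AD|lA F]; first by apply: lA => //; rewrite DE.
  rewrite DE => FD AF; apply: leq_ltn_trans (subset_leq_card FD) (lA _).
  exact: subset_trans FD.
(* A simplex has a single facet, so only the layer of its own size is nonzero, and one step with R
   empty fills it. *)
have [eqd|ned] := eqVneq #|~: D| d.
  apply: (@clean_step _ _ _ _ set0 (~: D)) => //; try exact: sub0set.
    by move=> A _; rewrite lowE eqd ltnn implybF negbK.
  have -> : low (link_del C D) d :|: up set0 = low (link_del C D) d.+1; last exact: clean_refl.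
  by apply/setP=> A; rewrite inE [A \in up _]inE sub0set orbT lowE eqd ltnSn implybT.
have -> : low (link_del C D) d.+1 = low (link_del C D) d; last exact: clean_refl.
by apply/setP=> A; rewrite !lowE ltnS leq_eqVlt (negPf ned).
Qed.

End Layers.

(** * The filtration of the quotient ring *)

Section QuotientModules.

Variables (R : nzRingType) (V : lmodType R).

Definition submod_of (P : {pred V}) of submod_closed P : {pred V} := P.

HB.instance Definition _ (P : {pred V}) (sP : submod_closed P) :=
  GRing.isSubmodClosed.Build R V (submod_of sP) sP.

Lemma pi_quotmod_eq (N : submodClosed V) (x y : V) :
  (\pi_(quotmod N) x == \pi_(quotmod N) y) = (x - y \in N).
Proof. by rewrite -Quotient.idealrBE. Qed.

Lemma pi_quotmod_eq0 (N : submodClosed V) (x : V) :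
  (\pi_(quotmod N) x == 0) = (x \in N).
Proof. by rewrite -(raddf0 (\pi_(quotmod N))) pi_quotmod_eq subr0. Qed.

Lemma pi_quotmodBZ (N : submodClosed V) a (x y : V) :
  \pi_(quotmod N) (x - a *: y) = \pi_(quotmod N) x - a *: \pi_(quotmod N) y.
Proof. by rewrite quotmod_scaleE -(raddfB (\pi_(quotmod N))). Qed.

Lemma repr_quotmod (N : submodClosed V) (x : V) :
  repr (\pi_(quotmod N) x) - x \in N.
Proof. by rewrite -pi_quotmod_eq reprK. Qed.

End QuotientModules.

Section Subquotients.

Variables (R : nzRingType) (V : lmodType R).

Definition subquot_pi (N N' : submodClosed V) (x : V) : subquot N N' :=
  \pi_(quotmod (@trace_pred R V N N')) (insubd (0 : submod N') x).

Lemma subquot_piP (N N' : submodClosed V) (y : subquot N N') :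
  exists2 x, x \in N' & y = subquot_pi N N' x.
Proof.
exists (val (repr y)); first exact: valP.
by rewrite /subquot_pi valKd reprK.
Qed.

Lemma subquot_piB (N N' : submodClosed V) a x y : x \in N' -> y \in N' ->
  subquot_pi N N' (x - a *: y) = subquot_pi N N' x - a *: subquot_pi N N' y.
Proof.
move=> Nx Ny; have Nxy : x - a *: y \in N' by rewrite -scaleNr rpredD ?rpredZ.
rewrite /subquot_pi quotmod_scaleE -(raddfB (\pi_(quotmod _))).
congr (\pi_ _ _); apply: val_inj.
have valB (u v : submod N') : \val (u - a *: v) = \val u - a *: \val v.
  by rewrite raddfB linearZ.
by rewrite valB !insubdK.
Qed.

Lemma subquot_pi_eq0 (N N' : submodClosed V) x : x \in N' ->
  subquot_pi N N' x = 0 <-> x \in N.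
Proof.
move=> Nx; have := pi_quotmod_eq0 (@trace_pred R V N N') (insubd 0 x).
rewrite -[X in _ = X]/(\val (insubd (0 : submod N') x) \in N) insubdK // => <-.
by split=> [H|/eqP//]; apply/eqP.
Qed.

End Subquotients.

(** Removes repetitions from a chain: D lists the indices after which U changes, and the default a +
    m of [nth] stands for the end of the chain. *)
Lemma filter_changes (T : eqType) (U : nat -> T) a m :
  let D := [seq d <- iota a m | U d != U d.+1] in
  U a = U (nth (a + m)%N D 0) /\
  forall i, (i < size D)%N -> U (nth (a + m)%N D i).+1 = U (nth (a + m)%N D i.+1).
Proof.
elim: m a => [|m IHm] a /=; first by rewrite addn0.
have [IH0 IHS] := IHm a.+1; rewrite -addSnnS.
by case: eqP => /= [->//|_]; split=> // -[|i] //=; exact: IHS.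
Qed.

Section MonomialFiltration.

Variables (k : fieldType) (n : nat).
Local Notation S := {mpoly k[n]}.
Implicit Types (p q : S).

Lemma mcoeff_pihomog d p m :
  (pihomog mdeg d p)@_m = if mdeg m == d then p@_m else 0.
Proof.
elim/mpolyind: p => [|c m' p _ _ IHp]; first by rewrite raddf0 mcoeff0 if_same.
rewrite linearP /= pihomogX !mcoeffD !mcoeffZ IHp mcoeffX.
case: (eqVneq m' m) => [->|nem].
  by case: ifP => _; rewrite ?mcoeffX ?eqxx // mcoeff0 mulr0 addr0.
rewrite mulr0 add0r.
by case: (mdeg m' == d); rewrite ?mcoeff0 ?mcoeffX ?(negPf nem) mulr0 add0r.
Qed.

Lemma dhomog_mcoeff d p m : p \is d.-homog -> p@_m != 0 -> mdeg m = d.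
Proof. by move=> /dhomogP hp; rewrite -mcoeff_msupp => /hp. Qed.

Section FixedIdeal.

Variables (I : submodClosed S^o) (W0 : {set {set 'I_n}}).
Hypothesis IE : I =i mono_ideal W0.

Local Notation pi := (\pi_(quotmod I)).

Lemma finitely_generated_quotmod : finitely_generated (quotmod I).
Proof.
exists [:: pi (1 : S^o)] => x; exists (fun=> repr x).
by rewrite big_ord1 /= quotmod_scaleE -[_ *: 1]/((repr x : S) * 1) mulr1 reprK.
Qed.

Lemma quot_grading0 d : quot_grading d (0 : quotmod I).
Proof. by case: d => //= e; exists 0; rewrite ?rpred0 ?raddf0. Qed.

(** The monomials of a homogeneous component occur in p, so one decomposition serves every monomial
    ideal containing p, hence all terms of the filtration. *)
Lemma pi_homog_decomposition p : exists (s : seq int) (c : int -> S),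
  [/\ uniq s, forall d, quot_grading d (pi (c d)) /\
         (forall W, p \in mono_ideal W -> c d \in mono_ideal W)
     & pi p = \sum_(d <- s) pi (c d)].
Proof.
exists [seq Posz i | i <- iota 0 (msize p)],
       (fun d => if d is Posz e then pihomog mdeg e p else 0); split.
- by rewrite map_inj_uniq ?iota_uniq // => i j [].
- case=> [e|e]; split=> [|W Wp] /=.
  + by exists (pihomog mdeg e p) => //; exact: pihomogP.
  + apply/mono_idealP => m; rewrite mcoeff_pihomog.
    by case: ifP => _; [exact: (mono_idealP _ _ Wp)|rewrite eqxx].
  + exact: (raddf0 pi).
  by apply/mono_idealP => m; rewrite mcoeff0 eqxx.
have -> : iota 0 (msize p) = index_iota 0 (msize p) by rewrite /index_iota subn0.
rewrite big_map big_mkord /=.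
by rewrite -(raddf_sum pi) -pihomog_partitionE.
Qed.

Lemma quot_gradingP : is_grading (@quot_grading k n I).
Proof.
split.
- move=> d; split; first exact: quot_grading0.
  move=> x y; case: d => [e|e] /=; last by move=> -> ->; rewrite subr0.
  move=> [p hp ->] [q hq ->]; exists (p - q); first exact: rpredB.
  by rewrite (raddfB pi).
- move=> e [f|f] p x hp /=; last by move=> ->; rewrite scaler0; exact: quot_grading0.
  case=> q hq ->; exists (p * q); first exact: dhomogM.
  by rewrite quotmod_scaleE.
- move=> x; have [s [c [us hc Ec]]] := pi_homog_decomposition (repr x).
  exists s, (fun d => pi (c d)); split=> //; first by move=> d; case: (hc d).
  by rewrite -Ec reprK.
move=> s c us hc c0 d sd.
(* Homogeneous representatives of different degrees share no monomial, so a monomial ideal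
   containing their sum contains each of them. *)
have /choice[P PE] : forall d, exists p : S, c d = pi p /\
    forall m, p@_m != 0 -> d = Posz (mdeg m).
  move=> d'; have := hc d'; case: d' => [e [p hp ->]|e ->].
    by exists p; split=> // m /(dhomog_mcoeff hp)->.
  by exists 0; split=> [|m]; [exact/esym/(raddf0 pi)|rewrite mcoeff0 eqxx].
have [-> Pd] := PE d.
have : pi (\sum_(d <- s) (P d : S^o)) == 0.
  rewrite (raddf_sum pi) /=; apply/eqP; rewrite -[RHS]c0.
  by apply: eq_bigr => d' _; case: (PE d').
rewrite pi_quotmod_eq0 IE => /mono_idealP W0P.
apply/eqP; rewrite pi_quotmod_eq0 IE; apply/mono_idealP => m Pm.
apply: W0P; rewrite raddf_sum /= (bigD1_seq d) //= big1 ?addr0 // => d' ned.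
have [_ Pd'] := PE d'; apply/eqP; apply: contraNT ned => /Pd'->.
by rewrite (Pd _ Pm).
Qed.

Lemma mono_filtration (U : nat -> {set {set 'I_n}}) V N : U 0%N = W0 -> U N = setT ->
  (forall d, upset (U d)) -> (forall d, clean V d (U d) (U d.+1)) ->
  quotient_sequentially_CM I.
Proof.
move=> U0 UN upU cU.
have sU d d' : (d <= d')%N -> U d \subset U d'.
  move=> /subnK <-; elim: (d' - d)%N => // e IHe.
  exact: subset_trans IHe (clean_sub (cU _)).
(* Every term contains I, so membership does not depend on the representative. *)
have piU d p : (repr (pi p) \in mono_ideal (U d)) = (p \in mono_ideal (U d)).
  have sub q : q \in I -> q \in mono_ideal (U d).
    by rewrite IE -U0; apply/mono_ideal_sub/sU.
  have sUd := mono_ideal_submodule k (upU d).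
  have H := sub _ (repr_quotmod I p).
  apply/idP/idP => Hp; last by rewrite -[repr _](subrK p); apply: (submoduleD sUd).
  by rewrite -[p](subKr (repr (pi p))); apply: (submoduleB sUd).
pose Q d : {pred quotmod I} := [pred x | (repr x : S) \in mono_ideal (U d)].
have Qpi d p : (pi p \in Q d) = (p \in mono_ideal (U d)) by exact: piU.
have sQ d : submod_closed (Q d).
  have sUd := mono_ideal_submodule k (upU d).
  split=> [|a x y]; first by rewrite -(raddf0 pi) Qpi; apply: submodule0 sUd.
  rewrite -[x]reprK -[y]reprK quotmod_scaleE -(raddfD pi) !Qpi => Hx Hy.
  by apply: (submoduleD sUd) => //; apply: (submoduleZ a sUd).
split; [exact: quot_gradingP | exact: finitely_generated_quotmod |].
(* Keeping only the jumps of U makes the inclusions strict. The factor at a jump d has dimension d,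
   so D is also the increasing list of dimensions. *)
pose D := [seq d <- iota 0 N | U d != U d.+1].
pose J d : submodClosed (quotmod I) := submod_of (sQ d).
exists (size D), (fun i => J (nth N D i)), (nth N D).
have [D0 DS] := filter_changes U 0 N; rewrite -/D add0n in D0 DS.
have DP i : (i < size D)%N -> U (nth N D i) != U (nth N D i.+1).
  by move=> lti; rewrite -DS //; have := mem_nth N lti; rewrite mem_filter => /andP[].
have JE d p : (pi p \in J d) = (p \in mono_ideal (U d)) by exact: Qpi.
have CM i : (i < size D)%N ->
    cohen_macaulay (subquot (J (nth N D i)) (J (nth N D i.+1))) /\
    krull_dim_is (subquot (J (nth N D i)) (J (nth N D i.+1))) (nth N D i).
  move=> lti; set d := nth N D i; set d' := nth N D i.+1.
  have Ud' : U d.+1 = U d' by exact: DS.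
  apply: (clean_CM (f := fun p => subquot_pi (J d) (J d') (pi p)) (upU d) (cU d)).
    by rewrite Ud'; exact: DP.
  rewrite Ud'; split=> // [a x y Jx Jy|y _|x Jx].
  - by rewrite pi_quotmodBZ subquot_piB // JE.
  - have [x Jx ->] := subquot_piP y; exists (repr x).
      by rewrite /in_mono -JE reprK.
    by rewrite reprK subrr.
  - by rewrite subquot_pi_eq0 JE.
split.
- split=> x; rewrite -[x]reprK JE.
    by rewrite -D0 U0 -IE inE pi_quotmod_eq0.
  by rewrite nth_default // UN; exact: in_mono_setT.
- move=> i _ x; rewrite -[x]reprK JE => Jx.
  have [s [c [us hc Ec]]] := pi_homog_decomposition (repr x).
  exists s, (fun d => pi (c d)); split=> // d; have [gc Jc] := hc d.
  by split=> //; rewrite JE; apply: Jc.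
- move=> i lti; split=> [x|sub].
    rewrite -[x]reprK !JE; apply: mono_ideal_sub.
    by rewrite -DS //; apply: sU.
  have := DP i lti; rewrite eqEsubset -DS // sU //=; case/subsetPn=> A UA nUA.
  have /sub : pi 'X_[mesym1 A] \in J (nth N D i.+1).
    by rewrite JE mem_mono_idealX msupport_mesym1 -DS.
  by rewrite JE mem_mono_idealX msupport_mesym1 (negPf nUA).
- move=> i lti; by have [] := CM i lti.
split=> [i lti|i j /andP[ltij ltj]]; first by have [] := CM i lti.
have sD : sorted ltn D by apply: sorted_filter (iota_ltn_sorted _ _); exact: ltn_trans.
by apply: (sorted_ltn_nth ltn_trans) => //; rewrite inE (ltn_trans ltij).
Qed.

End FixedIdeal.
End MonomialFiltration.

(** * Ideals generated by intervals *)

Section IntervalIdeals.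

Variables (k : fieldType) (n : nat).
Implicit Types (E : {set {set 'I_n}}) (e A : {set 'I_n}).

Definition upclosure E : {set {set 'I_n}} :=
  [set A : {set 'I_n} | [exists e in E, e \subset A]].

Lemma upclosure_upset E : upset (upclosure E).
Proof.
move=> A B; rewrite !inE => /exists_inP[e Ee seA] sAB; apply/exists_inP.
by exists e => //; apply: subset_trans sAB.
Qed.

Lemma sqfree_mono_ideal E : sqfree_ideal k E =i mono_ideal (upclosure E).
Proof.
have sU := mono_ideal_submodule k (upclosure_upset (E := E)).
move=> p; apply/idP/idP.
  case/asboolP=> y ->; elim/big_ind: _ => [|u v|i _].
  - exact: submodule0 sU.
  - exact: submoduleD sU.
  have : nth 0 [seq xmon k F | F <- enum E] i \in [seq xmon k F | F <- enum E].
    exact: mem_nth.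
  case/mapP=> F; rewrite mem_enum => EF ->; rewrite /GRing.scale /= mulrC.
  apply: (submoduleZ _ sU); rewrite /in_mono xmonE mem_mono_idealX msupport_mesym1 inE.
  by apply/exists_inP; exists F.
move: p; apply: mono_ideal_ind => [|m].
  split=> [|a x y Ix Iy]; first exact: rpred0.
  by rewrite -scaleNr rpredD ?rpredZ.
rewrite inE => /exists_inP[e Ee sem].
have -> : 'X_[m] = 'X_[m - mesym1 e] * xmon k e.
  rewrite xmonE -mpolyXD submK //; apply/mnm_lepP => i; rewrite mnmE.
  by have := subsetP sem i; rewrite inE -lt0n; case: (i \in e) => // ->.
apply: (rpredZ (V := {mpoly k[n]}^o)); apply/mem_ideal_gen/mapP.
by exists e; rewrite ?mem_enum.
Qed.

Lemma interval_ideal_sequentially_CM E (I : submodClosed {mpoly k[n]}^o) :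
  (forall e, e \in E -> forall i j l : 'I_n,
     i \in e -> l \in e -> (i <= j)%N -> (j <= l)%N -> j \in e) ->
  I =i sqfree_ideal k E -> quotient_sequentially_CM I.
Proof.
move=> convE IE; pose U := low (link_del E set0 set0).
have IU p : (p \in I) = (p \in mono_ideal (upclosure E)).
  by rewrite IE sqfree_mono_ideal.
have DE A : (A \in link_del E set0 set0) = (A \notin upclosure E).
  rewrite !inE setC0 subsetT /=; congr (~~ _); apply: eq_existsb => e.
  by rewrite setU0.
(* The chain starts at the nonfaces for d = 0 and is exhausted at n + 1, since no face has more than
   n vertices. *)
apply: (mono_filtration IU (U := U) (V := ~: (set0 :|: set0)) (N := n.+1)).
- apply/setP=> A; apply/lowP/idP => [lA|EA F].
    by apply: contraT; rewrite -DE => /lA/(_ (subxx A)).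
  by rewrite DE => /negP nEF sAF; case: nEF; apply: upclosure_upset sAF.
- apply/setP=> A; rewrite [RHS]inE; apply/lowP => F _ _.
  by rewrite ltnS -[X in (_ <= X)%N]card_ord max_card.
- by move=> d; apply: low_upset.
by move=> d; apply: clean_link_del; rewrite ?sub0set.
Qed.

End IntervalIdeals.

Lemma closed_nbhd_path_square_convex n e : e \in closed_nbhds (path_square n) ->
  forall i j l : 'I_n, i \in e -> l \in e -> (i <= j)%N -> (j <= l)%N -> j \in e.
Proof.
case/imsetP=> x _ -> i j l; rewrite !inE -!val_eqE /= /path_square_rel.
lia.
Qed.

Theorem theorem2p6 (k : fieldType) (n : nat) (hn : (7 <= n)%N) :
  quotient_sequentially_CM (NI k (path_square n)) /\
  quotient_sequentially_CM
    (stanley_reisner_ideal k (SR (nbhd_complex (path_square n)))).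
Proof.
have NIE := @NI_sqfree k n (path_square n).
have conv := @closed_nbhd_path_square_convex n.
(* Both ideals coincide with the one generated by the closed neighbourhoods. *)
split; apply: (interval_ideal_sequentially_CM conv) => // p.
by rewrite stanley_reisner_ideal_SR facet_ideal_nbhd_complex NIE.
Qed.
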